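(* Let $A$ be a Banach algebra. The following conditions are equivalent: (i) $A$ is amenable. (ii) There exists a net $\{M_\nu\}$ in $(A_+\mathbin{\widehat\otimes}A_+)^{**}$ such that $\pi_+^{**}(M_\nu)\to i_{A_+}(1_+)$ in norm and $a\cdot M_\nu-M_\nu\cdot a\to0$ in norm, uniformly on bounded subsets of $A_+$ (i.e. uniformly for $a$ ranging over any bounded subset of $A_+$).
   Context: Banach algebras are not assumed unital. $A_+$ is the unitization of $A$ and $1_+$ is its identity. $\widehat\otimes$ is the completed projective tensor product of Banach spaces; $\pi_+\colon A_+\mathbin{\widehat\otimes}A_+\to A_+$ is the product map, $\pi_+(a\otimes b)=ab$; $i_X\colon X\to X^{**}$ is the canonical embedding. $A_+\mathbin{\widehat\otimes}A_+$ is a Banach $A_+$-bimodule via $a\cdot(b\otimes c)=ab\otimes c$, $(b\otimes c)\cdot a=b\otimes ca$. The dual of a Banach bimodule $X$ is a Banach bimodule via $(a\cdot f)(x)=f(x\cdot a)$, $(f\cdot a)(x)=f(a\cdot x)$; the second dual carries the resulting structure. $A$ is amenable if for each Banach $A$-bimodule $X$ every continuous derivation from $A$ to $X^*$ is inner (of the form $a\mapsto a\cdot x-x\cdot a$ for some $x\in X^*$). *)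

(* Defs.v *)
From HB Require Import structures.
From mathcomp Require Import all_boot all_order all_algebra.
From mathcomp Require Import boolp classical_sets functions reals topology normedtype.
From mathcomp Require Import complex.

Set Implicit Arguments.
Unset Strict Implicit.
Unset Printing Implicit Defensive.

Import Order.TTheory GRing.Theory Num.Theory.
Import numFieldNormedType.Exports.

Local Open Scope classical_set_scope.
Local Open Scope complex_scope.
Local Open Scope ring_scope.

(* Norms of complex normed spaces are valued in [R[i]]; [rnorm] is the same
   norm as a real number. *)
Section RealNorm.
Context {R : realType}.

Definition rnorm {V : normedModType R[i]} (x : V) : R := complex.Re `|x|.

Lemma ge0_ReE (z : R[i]) : 0 <= z -> z = (complex.Re z)%:C.
Proof. by case: z => a b; rewrite lecE /= => /andP[/eqP -> _]. Qed.

Context {V : normedModType R[i]}.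
Implicit Types x y : V.

Lemma rnormE x : `|x| = (rnorm x)%:C. Proof. exact: ge0_ReE. Qed.

Lemma rnorm_ge0 x : 0 <= rnorm x.
Proof. by rewrite -ler0c -rnormE. Qed.

Lemma rnormD x y : rnorm (x + y) <= rnorm x + rnorm y.
Proof. by rewrite -lecR rmorphD /= -!rnormE ler_normD. Qed.

Lemma rnormZ (c : R[i]) x : rnorm (c *: x) = complex.Re `|c| * rnorm x.
Proof.
apply: complexI; rewrite rmorphM /= -rnormE normrZ -ge0_ReE // -rnormE.
Qed.

Lemma rnorm0 : rnorm (0 : V) = 0.
Proof. by rewrite /rnorm normr0. Qed.

Lemma rnorm0_eq0 x : rnorm x = 0 -> x = 0.
Proof. by move=> x0; apply/eqP; rewrite -normr_eq0 rnormE x0. Qed.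

Lemma rnormN x : rnorm (- x) = rnorm x.
Proof. by rewrite /rnorm normrN. Qed.

Lemma rdistC x y : rnorm (x - y) = rnorm (y - x).
Proof. by rewrite /rnorm distrC. Qed.

Lemma rdist_tri x y z : rnorm (x - z) <= rnorm (x - y) + rnorm (y - z).
Proof. by rewrite (le_trans _ (rnormD _ _))// addrA subrK. Qed.

Lemma eq0_rnorm_small x : (forall e : R, 0 < e -> rnorm x <= e) -> x = 0.
Proof.
move=> xe; apply: rnorm0_eq0; apply/eqP; rewrite eq_le rnorm_ge0 andbT.
by apply/ler_addgt0Pr => e e0; rewrite add0r; exact: xe.
Qed.

Definition cauchy_seq (u : nat -> V) := forall e : R, 0 < e ->
  exists N, forall m n, (N <= m)%N -> (N <= n)%N -> rnorm (u m - u n) < e.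

Definition seq_lim (u : nat -> V) (l : V) := forall e : R, 0 < e ->
  exists N, forall n, (N <= n)%N -> rnorm (u n - l) < e.

Lemma seq_lim_unique u l l' : seq_lim u l -> seq_lim u l' -> l = l'.
Proof.
move=> ul ul'; apply/subr0_eq/eq0_rnorm_small => e e0.
have e20 : 0 < e / 2 by rewrite divr_gt0.
have [N hN] := ul _ e20; have [N' hN'] := ul' _ e20.
pose n := maxn N N'; rewrite (le_trans (rdist_tri _ (u n) _))//.
rewrite [leRHS](splitr e) lerD// ltW//; last by apply: hN'; rewrite leq_maxr.
by rewrite rdistC; apply: hN; rewrite leq_maxl.
Qed.

Lemma invS_lt (e : R) : 0 < e -> exists N, forall n, (N <= n)%N -> n.+1%:R^-1 < e.
Proof.
move=> e0; exists (Num.truncn e^-1) => n hn.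
rewrite invf_plt ?posrE// (lt_le_trans (truncnS_gt _))//.
by rewrite ler_nat ltnS.
Qed.

Lemma seq_complete : (forall u, cauchy_seq u -> exists l, seq_lim u l) ->
  forall F : set_system V, ProperFilter F -> cauchy F -> cvg F.
Proof.
move=> sc F FF /cauchyP Fc.
have /choice[x xF] : forall n : nat, exists x : V, F (ball x (n.+1%:R^-1)%:C).
  by move=> n; apply: Fc; rewrite ltcR invr_gt0.
have dx m n : rnorm (x m - x n) < m.+1%:R^-1 + n.+1%:R^-1.
  have [y [my ny]] : exists y, (ball (x m) (m.+1%:R^-1)%:C `&` ball (x n) (n.+1%:R^-1)%:C) y.
    by apply: (@filter_ex _ F); apply: filterI.
  move: my ny; rewrite -!ball_normE /ball_/= !rnormE !ltcR => my ny.
  by rewrite (le_lt_trans (rdist_tri _ y _))// ltrD// rdistC.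
have [e e0|l xl] := sc x.
  have [N hN] := invS_lt (divr_gt0 e0 (ltr0n _ 2)).
  exists N => m n hm hn; rewrite (lt_trans (dx _ _))// (splitr e) ltrD//; exact: hN.
apply/cvg_ex; exists l; apply/cvgrPdist_lt => e e0.
have e1 : 0 < complex.Re e by move: e0; rewrite ltcE /= => /andP[].
have eE : e = (complex.Re e)%:C by apply: ge0_ReE; exact: ltW.
have [N hN] := invS_lt (divr_gt0 e1 (ltr0n _ 2)).
have [N' hN'] := xl _ (divr_gt0 e1 (ltr0n _ 2)).
pose n := maxn N N'.
apply: filterS (xF n) => y; rewrite -ball_normE /ball_/= eE !rnormE !ltcR => xy.
rewrite (le_lt_trans (rdist_tri _ (x n) _))// (splitr (complex.Re e)) ltrD//.
  by rewrite rdistC; apply: hN'; rewrite leq_maxr.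
by rewrite (lt_trans xy)//; apply: hN; rewrite leq_maxl.
Qed.

End RealNorm.

Lemma complete_seq (R : realType) (V : completeNormedModType R[i]) (u : nat -> V) :
  cauchy_seq u -> exists l, seq_lim u l.
Proof.
move=> uc; have /cauchy_cvg/cvg_ex[l ul] : cauchy (u @ \oo).
  apply/cauchyP => e e0.
  have e1 : 0 < complex.Re e by move: e0; rewrite ltcE /= => /andP[].
  have eE : e = (complex.Re e)%:C by apply: ge0_ReE; exact: ltW.
  have [N hN] := uc _ e1; exists (u N); exists N => // n /= Nn.
  by rewrite -ball_normE /ball_/= eE rnormE ltcR; exact: hN.
exists l => e e0; move/cvgrPdist_lt : ul => /(_ e%:C).
rewrite ltcR => /(_ e0)[N _ hN]; exists N => n Nn.
by have := hN n Nn; rewrite /= rnormE ltcR rdistC.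
Qed.

(* [complex R] has no module structure over itself in its own library: give it
   the one of the regular module [R[i]^o], with the modulus as norm. *)
HB.instance Definition _ (R : realType) := GRing.ComAlgebra.copy R[i] R[i]^o.
HB.instance Definition _ (R : realType) := NormedModule.copy R[i] R[i]^o.
Section ComplexComplete.
Context {R : realType}.

Let real_cauchy_seq (u : nat -> R) :
  (forall e : R, 0 < e ->
    exists N, forall m n, (N <= m)%N -> (N <= n)%N -> `|u m - u n| < e) ->
  exists l, forall e : R, 0 < e ->
    exists N, forall n, (N <= n)%N -> `|u n - l| < e.
Proof.
move=> uc; have /cauchy_cvg/cvg_ex[l ul] : cauchy (u @ \oo).
  apply/cauchyP => e e0.
  have [N hN] := uc _ e0; exists (u N); exists N => // n /= Nn.
  by rewrite -ball_normE /ball_/=; exact: hN.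
exists l => e e0; move/cvgrPdist_lt : ul => /(_ e e0)[N _ hN]; exists N => n Nn.
by have := hN n Nn; rewrite /= distrC.
Qed.

Let norm_i : `|'i : R[i]| = 1.
Proof. by rewrite normc_def /= expr0n add0r expr1n sqrtr1. Qed.

Let norm_real (x : R) : `|x%:C| = `|x|%:C.
Proof. by rewrite normc_def /= expr0n addr0 sqrtr_sqr. Qed.

Let rnorm_Re (z : R[i]) : `|complex.Re z| <= rnorm z.
Proof. by have := normc_ge_Re z; rewrite rnormE lecR. Qed.

Let rnorm_Im (z : R[i]) : `|complex.Im z| <= rnorm z.
Proof.
have := rnorm_Re (z * 'i); rewrite ReiNIm normrN => /le_trans; apply.
by rewrite /rnorm normrM norm_i mulr1.
Qed.

Let rnorm_ReIm (z : R[i]) : rnorm z <= `|complex.Re z| + `|complex.Im z|.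
Proof.
rewrite -lecR -rnormE {1}[z]complexE rmorphD /= (le_trans (ler_normD _ _))//.
by rewrite normrM norm_i mul1r !norm_real.
Qed.

Let complex_complete (F : set_system R[i]) :
  ProperFilter F -> cauchy F -> cvg F.
Proof.
apply: seq_complete => u uc.
have [e e0|a ua] := real_cauchy_seq (u := fun n => complex.Re (u n)).
  have [N hN] := uc _ e0; exists N => m n hm hn.
  by rewrite -raddfB/= (le_lt_trans (rnorm_Re _))//; exact: hN.
have [e e0|b ub] := real_cauchy_seq (u := fun n => complex.Im (u n)).
  have [N hN] := uc _ e0; exists N => m n hm hn.
  by rewrite -raddfB/= (le_lt_trans (rnorm_Im _))//; exact: hN.
exists (a +i* b) => e e0.
have [N hN] := ua _ (divr_gt0 e0 (ltr0n _ 2)).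
have [N' hN'] := ub _ (divr_gt0 e0 (ltr0n _ 2)).
exists (maxn N N') => n; rewrite geq_max => /andP[Nn N'n].
rewrite (le_lt_trans (rnorm_ReIm _))// (splitr e) ltrD//.
  by case: (u n) (hN n Nn).
by case: (u n) (hN' n N'n).
Qed.

HB.instance Definition _ := Uniform_isComplete.Build R[i] complex_complete.

End ComplexComplete.

Section BoundedOperators.
Context {R : realType}.

Section Def.
Variables E F : normedModType R[i].

Definition is_blin : {pred E -> F} :=
  [pred f | `[< linear f /\ continuous f >]].

Record blin := Blin { blin_fun :> E -> F; blinP : blin_fun \in is_blin }.

HB.instance Definition _ := [isSub for blin_fun].
HB.instance Definition _ := [Choice of blin by <:].

Let is_blin_submod : submod_closed is_blin.
Proof.
split=> [|c f g].
  apply/asboolP; split; first by move=> a x y /=; rewrite scaler0 addr0.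
  by move=> x; exact: cvg_cst.
move=> /asboolP[fl fc] /asboolP[gl gc]; apply/asboolP; split.
  move=> a x y /=.
  rewrite /= !fctE fl gl !scalerDr !scalerA [c * a]mulrC.
  by rewrite addrACA.
by move=> x; apply: cvgD; [apply: cvgZr; exact: fc|exact: gc].
Qed.

HB.instance Definition _ :=
  GRing.isSubmodClosed.Build R[i] (E -> F) is_blin is_blin_submod.
HB.instance Definition _ := [SubChoice_isSubLmodule of blin by <:].

Section Theory.
Implicit Types f g : blin.

Lemma blin_linear f : linear f. Proof. by case: f => f /= /asboolP[]. Qed.

HB.instance Definition _ f :=
  GRing.isLinear.Build R[i] E F _ (blin_fun f) (blin_linear f).

Lemma blin_continuous f : continuous f.
Proof. by case: f => f /= /asboolP[]. Qed.

Lemma blin_ext f g : (forall x, f x = g x) -> f = g.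
Proof. by move=> fg; apply/val_inj/funext. Qed.

Lemma blinDE f g x : (f + g) x = f x + g x. Proof. by []. Qed.
Lemma blinBE f g x : (f - g) x = f x - g x. Proof. by []. Qed.
Lemma blinZE c f x : (c *: f) x = c *: f x. Proof. by []. Qed.
Lemma blin0E x : (0 : blin) x = 0. Proof. by []. Qed.

End Theory.

Lemma bounded_is_blin (f : E -> F) (M : R) : linear f ->
  (forall x, rnorm (f x) <= M * rnorm x) -> f \in is_blin.
Proof.
move=> fl fM; apply/asboolP; split => //.
pose f' : {linear E -> F} :=
  HB.pack f (GRing.isLinear.Build R[i] E F _ f fl).
apply: (@bounded_linear_continuous _ _ _ f').
apply/linear_boundedP; exists M%:C; split; first by rewrite Num.Theory.realE -(rmorph0 (real_complex R)) !lecR le_total.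
move=> r Mr x; rewrite (@le_trans _ _ (M%:C * `|x|))//.
  by rewrite /= !rnormE -rmorphM lecR; exact: fM.
by rewrite ler_wpM2r// ltW.
Qed.

Definition mk_blin (f : E -> F) (M : R) fl fM : blin :=
  Blin (@bounded_is_blin f M fl fM).

Definition opnorm (f : blin) : R :=
  sup [set rnorm (f x) | x in [set x : E | rnorm x <= 1]].

Lemma blin_bounded (f : blin) :
  exists2 M : R, 0 <= M & forall x, rnorm (f x) <= M * rnorm x.
Proof.
have /continuous_linear_bounded-/(_ 0)/linear_boundedP : {for 0, continuous f}.
  exact: blin_continuous.
move=> /pinfty_ex_gt0[M M0 fM].
have ME : M = (complex.Re M)%:C by apply: ge0_ReE; exact: ltW.
exists (complex.Re M); first by rewrite -ler0c -ME ltW.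
by move=> x; rewrite -lecR rmorphM/= -ME -!rnormE; exact: fM.
Qed.

Let opnorm_has_sup (f : blin) :
  has_sup [set rnorm (f x) | x in [set x : E | rnorm x <= 1]].
Proof.
split; first by exists (rnorm (f 0)), 0 => //=; rewrite rnorm0.
have [M M0 fM] := blin_bounded f; exists M => _ [x x1 <-].
by rewrite (le_trans (fM x))// -[leRHS]mulr1 ler_wpM2l.
Qed.

Lemma opnorm_ge0 (f : blin) : 0 <= opnorm f.
Proof.
apply: (@le_trans _ _ (rnorm (f 0))); first exact: rnorm_ge0.
apply: ub_le_sup; first exact: (opnorm_has_sup f).2.
by exists 0 => //=; rewrite rnorm0.
Qed.

Lemma opnormP (f : blin) x : rnorm (f x) <= opnorm f * rnorm x.
Proof.
have [->|x0] := eqVneq x 0; first by rewrite raddf0 !rnorm0 mulr0.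
have nx0 : 0 < rnorm x.
  rewrite lt_neqAle rnorm_ge0 andbT eq_sym; apply: contra_neq x0.
  exact: rnorm0_eq0.
rewrite -ler_pdivrMr//.
have normV : complex.Re `|((rnorm x)^-1)%:C| = (rnorm x)^-1.
  by rewrite ger0_norm// ler0c invr_ge0 ltW.
apply: ub_le_sup; first exact: (opnorm_has_sup f).2.
exists (((rnorm x)^-1)%:C *: x) => /=.
  by rewrite rnormZ normV mulVf// gt_eqF.
by rewrite linearZ/= rnormZ normV mulrC.
Qed.

Lemma opnorm_le (f : blin) M : 0 <= M ->
  (forall x, rnorm (f x) <= M * rnorm x) -> opnorm f <= M.
Proof.
move=> M0 fM; apply: ge_sup; first exact: (opnorm_has_sup f).1.
by move=> _ [x x1 <-]; rewrite (le_trans (fM x))// -[leRHS]mulr1 ler_wpM2l.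
Qed.

Let blin_norm (f : blin) : R[i] := (opnorm f)%:C.

Let blin_normD f g : blin_norm (f + g) <= blin_norm f + blin_norm g.
Proof.
rewrite /blin_norm -rmorphD /= lecR; apply: opnorm_le.
  by rewrite addr_ge0// opnorm_ge0.
by move=> x; rewrite blinDE mulrDl (le_trans (rnormD _ _))// lerD// opnormP.
Qed.

Let opnormZ_le c f : opnorm (c *: f) <= complex.Re `|c| * opnorm f.
Proof.
have c0 : 0 <= complex.Re `|c| by rewrite -ler0c -ge0_ReE.
apply: opnorm_le; first by rewrite mulr_ge0// opnorm_ge0.
by move=> x; rewrite blinZE rnormZ -mulrA ler_wpM2l// opnormP.
Qed.

Let blin_normZ c f : blin_norm (c *: f) = `|c| * blin_norm f.
Proof.
rewrite /blin_norm [in RHS](@ge0_ReE _ `|c|)// -rmorphM; congr (_%:C).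
apply/eqP; rewrite eq_le opnormZ_le andTb.
have [->|c0] := eqVneq c 0; first by rewrite normr0 mul0r opnorm_ge0.
have c1 : 0 < complex.Re `|c| by rewrite -ltcR -ge0_ReE// normr_gt0.
rewrite -ler_pdivlMl// -[in leLHS](scalerK c0 f).
rewrite (le_trans (opnormZ_le _ _))// normfV.
rewrite (@ge0_ReE _ `|c|)// -fmorphV/=.
by rewrite le_refl.
Qed.

Let blin_norm0 f : blin_norm f = 0 -> f = 0.
Proof.
move=> /complexI f0; apply: blin_ext => x; apply: rnorm0_eq0.
by apply/eqP; rewrite eq_le rnorm_ge0 andbT (le_trans (opnormP f x))// f0 mul0r.
Qed.

HB.instance Definition _ := Lmodule_isNormed.Build R[i] blin
  blin_normD blin_normZ blin_norm0.

Lemma rnorm_blinE (f : blin) : rnorm f = opnorm f. Proof. by []. Qed.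

End Def.

Section Complete.
Variables (E : normedModType R[i]) (F : completeNormedModType R[i]).

Let blin_complete (G : set_system (blin E F)) :
  ProperFilter G -> cauchy G -> cvg G.
Proof.
apply: seq_complete => u uc.
have uxc x : cauchy_seq (fun n => u n x).
  move=> e e0; have [|N hN] := uc (e / (rnorm x + 1)).
    by rewrite divr_gt0// ltr_wpDl// rnorm_ge0.
  exists N => m n hm hn; rewrite -blinBE (le_lt_trans (opnormP _ _))//.
  rewrite (@le_lt_trans _ _ (opnorm (u m - u n) * (rnorm x + 1)))//.
    by rewrite ler_wpM2l ?opnorm_ge0// lerDl.
  by rewrite -ltr_pdivlMr ?ltr_wpDl ?rnorm_ge0//; exact: hN.
have /choice[g ug] : forall x, exists l, seq_lim (fun n => u n x) l.
  by move=> x; exact: complete_seq.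
have gl : linear g.
  move=> a x y; apply: (seq_lim_unique (ug _)) => e e0.
  have a0 : 0 <= complex.Re `|a| by rewrite -ler0c -ge0_ReE.
  have [N hN] := ug x (e / 2 / (complex.Re `|a| + 1)) (divr_gt0 (divr_gt0 e0 (ltr0n _ 2)) (ltr_wpDl a0 ltr01)).
  have [N' hN'] := ug y (e / 2) (divr_gt0 e0 (ltr0n _ 2)).
  exists (maxn N N') => n; rewrite geq_max => /andP[Nn N'n].
  rewrite linearP opprD addrACA -scalerBr (le_lt_trans (rnormD _ _))//.
  rewrite (splitr e) ltrD//; last exact: hN'.
  rewrite rnormZ (@le_lt_trans _ _ ((complex.Re `|a| + 1) * rnorm (u n x - g x)))//.
    by rewrite ler_wpM2r ?rnorm_ge0// lerDl.
  by rewrite mulrC -ltr_pdivlMr ?ltr_wpDl//; exact: hN.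
have gM (e : R) : 0 < e -> exists N, forall n, (N <= n)%N ->
    forall x, rnorm (u n x - g x) <= e * rnorm x.
  move=> e0; have [N hN] := uc _ e0; exists N => n Nn x.
  apply/ler_addgt0Pr => d d0; have [N' hN'] := ug x _ d0.
  pose m := maxn N N'.
  rewrite (le_trans (rdist_tri _ (u m x) _))// lerD//.
    rewrite -blinBE (le_trans (opnormP _ _))// ler_wpM2r ?rnorm_ge0//.
    by rewrite ltW//; apply: hN => //; rewrite leq_maxl.
  by rewrite ltW//; apply: hN'; rewrite leq_maxr.
have [N hN] := gM _ ltr01.
have gb x : rnorm (g x) <= (1 + opnorm (u N)) * rnorm x.
  rewrite -[g x](subrK (u N x)) (le_trans (rnormD _ _))// mulrDl lerD//.
    by rewrite rdistC; exact: hN.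
  exact: opnormP.
exists (mk_blin gl gb) => e e0.
have [N' hN'] := gM _ (divr_gt0 e0 (ltr0n _ 2)).
exists N' => n N'n; rewrite (@le_lt_trans _ _ (e / 2))//; last first.
  by rewrite ltr_pdivrMr// ltr_pMr// ltr1n.
apply: opnorm_le; first by rewrite divr_ge0// ltW.
by move=> x; exact: hN'.
Qed.

HB.instance Definition _ :=
  Uniform_isComplete.Build (blin E F) blin_complete.

End Complete.

End BoundedOperators.

Local Open Scope quotient_scope.

Definition bilinear_map (K : fieldType) (E F W : lmodType K) (f : E -> F -> W) :=
  (forall y, linear (f^~ y)) /\ (forall x, linear (f x)).

(* Elements of the algebraic tensor product are finite formal sums of pairs,
   two of which are identified when every bilinear map (into any vector space)
   takes the same value on them. *)
Section Tensor.
Context {K : fieldType}.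
Variables E F : lmodType K.
Implicit Types (s t : seq (E * F)).

Definition tsum (W : lmodType K) (f : E -> F -> W) s : W :=
  \sum_(p <- s) f p.1 p.2.

Definition tensor_eqv s t : bool :=
  `[< forall (W : lmodType K) (f : E -> F -> W), bilinear_map f ->
        tsum f s = tsum f t >].

Let tensor_eqv_refl : reflexive tensor_eqv.
Proof. by move=> s; apply/asboolP. Qed.

Let tensor_eqv_sym : symmetric tensor_eqv.
Proof. by move=> s t; apply/asboolP/asboolP => st W f fb; rewrite st. Qed.

Let tensor_eqv_trans : transitive tensor_eqv.
Proof.
move=> t s r /asboolP st /asboolP tr; apply/asboolP => W f fb.
by rewrite st// tr.
Qed.

Canonical tensor_equiv :=
  EquivRel tensor_eqv tensor_eqv_refl tensor_eqv_sym tensor_eqv_trans.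

Definition tensor := {eq_quot tensor_equiv}.

HB.instance Definition _ := Quotient.on tensor.
HB.instance Definition _ := Choice.on tensor.
HB.instance Definition _ := EqQuotient.on tensor.

Definition tens (x : E) (y : F) : tensor := \pi_tensor [:: (x, y)].

Definition tlift (W : lmodType K) (f : E -> F -> W) (u : tensor) : W :=
  tsum f (repr u).

Lemma tlift_pi (W : lmodType K) (f : E -> F -> W) s : bilinear_map f ->
  tlift f (\pi_tensor s) = tsum f s.
Proof.
move=> fb; have : \pi_tensor (repr (\pi_tensor s)) = \pi_tensor s by rewrite reprK.
by move=> /eqmodP/asboolP; apply.
Qed.

Lemma tensor_ext (u v : tensor) :
  (forall (W : lmodType K) (f : E -> F -> W), bilinear_map f ->
    tlift f u = tlift f v) -> u = v.
Proof.
move=> uv; rewrite -[u]reprK -[v]reprK; apply/eqmodP/asboolP => W f fb.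
exact: uv.
Qed.

Let tzero : tensor := \pi_tensor [::].
Let tadd (u v : tensor) : tensor := \pi_tensor (repr u ++ repr v).
Let tscale (c : K) (u : tensor) : tensor :=
  \pi_tensor [seq (c *: p.1, p.2) | p <- repr u].
Let topp := tscale (-1).

Let tlift0 W f : bilinear_map f -> @tlift W f tzero = 0.
Proof. by move=> fb; rewrite tlift_pi// /tsum big_nil. Qed.

Let tliftD W f u v : bilinear_map f ->
  @tlift W f (tadd u v) = tlift f u + tlift f v.
Proof. by move=> fb; rewrite tlift_pi// /tsum big_cat. Qed.

Let tliftZ W f c u : bilinear_map f -> @tlift W f (tscale c u) = c *: tlift f u.
Proof.
move=> fb; rewrite tlift_pi// /tsum big_map /tlift /tsum scaler_sumr.
apply: eq_bigr => -[x y] _ /=; have := (fb.1 y) c x 0.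
have := (fb.1 y) (-1) 0 0; rewrite scaler0 addr0 scaleN1r addNr => ->.
by rewrite !addr0.
Qed.

Let tliftN W f u : bilinear_map f -> @tlift W f (topp u) = - tlift f u.
Proof. by move=> fb; rewrite tliftZ// scaleN1r. Qed.

Let taddA : associative tadd.
Proof. by move=> u v w; apply: tensor_ext => W f fb; rewrite !tliftD// addrA. Qed.
Let taddC : commutative tadd.
Proof. by move=> u v; apply: tensor_ext => W f fb; rewrite !tliftD// addrC. Qed.
Let tadd0 : left_id tzero tadd.
Proof. by move=> u; apply: tensor_ext => W f fb; rewrite tliftD// tlift0// add0r. Qed.
Let taddN : left_inverse tzero topp tadd.
Proof.
by move=> u; apply: tensor_ext => W f fb; rewrite tliftD// tliftN// tlift0// addNr.
Qed.

HB.instance Definition _ := GRing.isZmodule.Build tensor taddA taddC tadd0 taddN.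

Let tscaleA a b u : tscale a (tscale b u) = tscale (a * b) u.
Proof. by apply: tensor_ext => W f fb; rewrite !tliftZ// scalerA. Qed.
Let tscale1 : left_id 1 tscale.
Proof. by move=> u; apply: tensor_ext => W f fb; rewrite tliftZ// scale1r. Qed.
Let tscaleDr : right_distributive tscale +%R.
Proof.
by move=> c u v; apply: tensor_ext => W f fb; rewrite !(tliftD, tliftZ)// scalerDr.
Qed.
Let tscaleDl u : {morph tscale^~ u : a b / a + b}.
Proof.
by move=> a b; apply: tensor_ext => W f fb; rewrite !(tliftD, tliftZ)// scalerDl.
Qed.

HB.instance Definition _ := GRing.Zmodule_isLmodule.Build K tensor
  tscaleA tscale1 tscaleDr tscaleDl.

Lemma tlift_linear (W : lmodType K) (f : E -> F -> W) : bilinear_map f ->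
  linear (tlift f).
Proof. by move=> fb c u v; rewrite tliftD// tliftZ. Qed.

Lemma tliftE (W : lmodType K) (f : E -> F -> W) x y : bilinear_map f ->
  tlift f (tens x y) = f x y.
Proof. by move=> fb; rewrite tlift_pi// /tsum big_seq1. Qed.

Lemma tlift_sum (W : lmodType K) (f : E -> F -> W) s : bilinear_map f ->
  tlift f (\sum_(p <- s) tens p.1 p.2) = tsum f s.
Proof.
move=> fb; pose f' : {linear tensor -> W} :=
  HB.pack (tlift f) (GRing.isLinear.Build K tensor W _ (tlift f) (tlift_linear fb)).
rewrite -[LHS]/(f' _) linear_sum; apply: eq_bigr => p _ /=; exact: tliftE.
Qed.

Lemma tens_sumE s : \pi_tensor s = \sum_(p <- s) tens p.1 p.2.
Proof. by apply: tensor_ext => W f fb; rewrite tlift_pi// tlift_sum. Qed.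

Lemma tensorP (u : tensor) : exists s, u = \sum_(p <- s) tens p.1 p.2.
Proof. by exists (repr u); rewrite -tens_sumE reprK. Qed.

Lemma tens_bilinear : bilinear_map tens.
Proof.
by split=> [y c x x'|x c y y']; apply: tensor_ext => W f fb;
  rewrite (tlift_linear fb) !tliftE//; [exact: (fb.1 y)|exact: (fb.2 x)].
Qed.

End Tensor.

Section Seminorm.
Context {R : realType}.

Record seminorm (V : lmodType R[i]) := Seminorm {
  snorm :> V -> R;
  snormD : forall x y, snorm (x + y) <= snorm x + snorm y;
  snormZ : forall c x, snorm (c *: x) = complex.Re `|c| * snorm x }.

Section Theory.
Variables (V : lmodType R[i]) (p : seminorm V).
Implicit Types x y z : V.

Lemma snorm0 : p 0 = 0.
Proof. by rewrite -(scale0r (0 : V)) snormZ normr0 mul0r. Qed.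

Lemma snormN x : p (- x) = p x.
Proof. by rewrite -scaleN1r snormZ normrN normr1 mul1r. Qed.

Lemma snorm_ge0 x : 0 <= p x.
Proof.
have := snormD p x (- x); rewrite subrr snorm0 snormN -mulr2n pmulrn_lge0//.
Qed.

Lemma sdistC x y : p (x - y) = p (y - x).
Proof. by rewrite -snormN opprB. Qed.

Lemma sdist_tri x y z : p (x - z) <= p (x - y) + p (y - z).
Proof. by rewrite (le_trans _ (snormD _ _ _))// addrA subrK. Qed.

End Theory.
End Seminorm.

Section ProjectiveSeminorm.
Context {R : realType}.
Variables E F : normedModType R[i].
Local Notation tensor := (tensor E F).
Implicit Types (u v : tensor) (s : seq (E * F)).

Let cost s : R := \sum_(p <- s) rnorm p.1 * rnorm p.2.

Definition proj_norm u : R :=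
  inf [set \sum_(p <- s) rnorm p.1 * rnorm p.2 |
       s in [set s : seq (E * F) | u = \sum_(p <- s) tens p.1 p.2]].

Let cost_ge0 s : 0 <= cost s.
Proof. by rewrite /cost sumr_ge0// => p _; rewrite mulr_ge0 ?rnorm_ge0. Qed.

Lemma proj_norm_le u s : u = \sum_(p <- s) tens p.1 p.2 ->
  proj_norm u <= \sum_(p <- s) rnorm p.1 * rnorm p.2.
Proof.
move=> us; apply: ge_inf; last by exists s.
by exists 0 => _ [t _ <-]; exact: cost_ge0.
Qed.

Lemma proj_norm_lt u (r : R) : proj_norm u < r ->
  exists2 s, u = \sum_(p <- s) tens p.1 p.2 &
    \sum_(p <- s) rnorm p.1 * rnorm p.2 < r.
Proof.
rewrite -subr_gt0 => ur.
have hi : has_inf [set \sum_(p <- s) rnorm p.1 * rnorm p.2 |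
    s in [set s : seq (E * F) | u = \sum_(p <- s) tens p.1 p.2]].
  split; last by exists 0 => _ [t _ <-]; exact: cost_ge0.
  by have [s us] := tensorP u; exists (cost s), s.
have [_ [s us <-]] := inf_adherent ur hi.
rewrite addrC subrK => sr.
by exists s.
Qed.

Let proj_normD u v : proj_norm (u + v) <= proj_norm u + proj_norm v.
Proof.
apply/ler_addgt0Pr => e e0; rewrite [e]splitr addrACA.
have e20 : 0 < e / 2 by rewrite divr_gt0.
have [s us sE] : exists2 s, u = \sum_(p <- s) tens p.1 p.2 &
  \sum_(p <- s) rnorm p.1 * rnorm p.2 < proj_norm u + e / 2.
  by apply: proj_norm_lt; rewrite ltrDl.
have [t vt tE] : exists2 s, v = \sum_(p <- s) tens p.1 p.2 &
  \sum_(p <- s) rnorm p.1 * rnorm p.2 < proj_norm v + e / 2.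
  by apply: proj_norm_lt; rewrite ltrDl.
apply: le_trans (ltW (ltrD sE tE)); rewrite -big_cat.
by apply: proj_norm_le; rewrite big_cat us vt.
Qed.

Let tensZl (c : R[i]) x y : tens (c *: x) y = c *: tens x y :> tensor.
Proof.
have b := (tens_bilinear E F).1 y.
have := b c x 0; rewrite addr0 => ->; have := b (-1) 0 0.
by rewrite scaler0 addr0 scaleN1r addNr => ->; rewrite addr0.
Qed.

Let proj_normZ_le (c : R[i]) u : proj_norm (c *: u) <= complex.Re `|c| * proj_norm u.
Proof.
have c0 : 0 <= complex.Re `|c| by rewrite -ler0c -ge0_ReE.
have key s : u = \sum_(p <- s) tens p.1 p.2 ->
    proj_norm (c *: u) <= complex.Re `|c| * \sum_(p <- s) rnorm p.1 * rnorm p.2.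
  move=> us; have := @proj_norm_le (c *: u) [seq (c *: p.1, p.2) | p <- s].
  rewrite !big_map /= => /(_ _)/le_trans; apply.
    by rewrite us scaler_sumr; apply: eq_bigr => p _; rewrite tensZl.
  by rewrite mulr_sumr; apply: ler_sum => p _; rewrite rnormZ mulrA.
have [c00|cn0] := eqVneq (complex.Re `|c|) 0.
  by have [s /key] := tensorP u; rewrite c00 !mul0r.
have cp : 0 < complex.Re `|c| by rewrite lt_neqAle eq_sym cn0.
apply/ler_addgt0Pr => e e0.
have [|s us sE] := @proj_norm_lt u (proj_norm u + e / complex.Re `|c|).
  by rewrite ltrDl divr_gt0.
rewrite (le_trans (key s us))// (le_trans (ler_wpM2l c0 (ltW sE)))//.
by rewrite mulrDr mulrCA divff// mulr1.
Qed.

Let proj_normZ (c : R[i]) u : proj_norm (c *: u) = complex.Re `|c| * proj_norm u.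
Proof.
apply/eqP; rewrite eq_le proj_normZ_le andTb.
have p0 v : 0 <= proj_norm v.
  apply: lb_le_inf; last by move=> _ [s _ <-]; exact: cost_ge0.
  by have [s us] := tensorP v; exists (cost s), s.
have [->|c0] := eqVneq c 0; first by rewrite normr0 mul0r p0.
have c1 : 0 < complex.Re `|c| by rewrite -ltcR -ge0_ReE// normr_gt0.
rewrite -ler_pdivlMl// -[in leLHS](scalerK c0 u).
rewrite (le_trans (proj_normZ_le _ _))// normfV.
by rewrite (@ge0_ReE _ `|c|)// -fmorphV.
Qed.

Definition proj_seminorm : seminorm tensor :=
  Seminorm proj_normD proj_normZ.

End ProjectiveSeminorm.

(* The completion consists of the Cauchy sequences modulo those tending to 0;
   it only needs a seminorm, since this quotient also kills the vectors of
   seminorm 0. *)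
Section Completion.
Context {R : realType}.

Section Def.
Variables (V : lmodType R[i]) (p : seminorm V).
Implicit Types (u v : nat -> V).

Definition scauchy u := forall e : R, 0 < e ->
  exists N, forall m n, (N <= m)%N -> (N <= n)%N -> p (u m - u n) < e.

Definition snull u := forall e : R, 0 < e ->
  exists N, forall n, (N <= n)%N -> p (u n) < e.

Record scauchy_seq := CauchySeq { cseq_val :> nat -> V; scauchyP : `[< scauchy cseq_val >] }.

HB.instance Definition _ := [isSub for cseq_val].
HB.instance Definition _ := [Choice of scauchy_seq by <:].

Let snullD u v : snull u -> snull v -> snull (fun n => u n + v n).
Proof.
move=> un vn e e0; have e20 : 0 < e / 2 by rewrite divr_gt0.
have [N hN] := un _ e20; have [N' hN'] := vn _ e20.
exists (maxn N N') => n; rewrite geq_max => /andP[Nn N'n].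
by rewrite (le_lt_trans (snormD _ _ _))// (splitr e) ltrD ?hN ?hN'.
Qed.

Let snullN u : snull u -> snull (fun n => - u n).
Proof.
by move=> un e e0; have [N hN] := un _ e0; exists N => n; rewrite snormN; exact: hN.
Qed.

Let snullZ (c : R[i]) u : snull u -> snull (fun n => c *: u n).
Proof.
have c0 : 0 <= complex.Re `|c| by rewrite -ler0c -ge0_ReE.
move=> un e e0; have [|N hN] := un (e / (complex.Re `|c| + 1)).
  by rewrite divr_gt0// ltr_wpDl.
exists N => n Nn; rewrite snormZ.
rewrite (@le_lt_trans _ _ ((complex.Re `|c| + 1) * p (u n)))//.
  by rewrite ler_wpM2r ?snorm_ge0// lerDl.
by rewrite mulrC -ltr_pdivlMr ?ltr_wpDl//; exact: hN.
Qed.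

Let snull_ext u v : u =1 v -> snull u -> snull v.
Proof. by move=> /funext ->. Qed.

Let snull0 : snull (fun=> 0).
Proof. by move=> e e0; exists 0%N => n _; rewrite snorm0. Qed.

Lemma scauchyD u v : scauchy u -> scauchy v -> scauchy (fun n => u n + v n).
Proof.
move=> un vn e e0; have e20 : 0 < e / 2 by rewrite divr_gt0.
have [N hN] := un _ e20; have [N' hN'] := vn _ e20.
exists (maxn N N') => m n; rewrite !geq_max => /andP[Nm N'm] /andP[Nn N'n].
by rewrite opprD addrACA (le_lt_trans (snormD _ _ _))// (splitr e) ltrD ?hN ?hN'.
Qed.

Lemma scauchyZ (c : R[i]) u : scauchy u -> scauchy (fun n => c *: u n).
Proof.
have c0 : 0 <= complex.Re `|c| by rewrite -ler0c -ge0_ReE.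
move=> un e e0; have [|N hN] := un (e / (complex.Re `|c| + 1)).
  by rewrite divr_gt0// ltr_wpDl.
exists N => m n Nm Nn; rewrite -scalerBr snormZ.
rewrite (@le_lt_trans _ _ ((complex.Re `|c| + 1) * p (u m - u n)))//.
  by rewrite ler_wpM2r ?snorm_ge0// lerDl.
by rewrite mulrC -ltr_pdivlMr ?ltr_wpDl//; exact: hN.
Qed.

Lemma scauchy_cst x : scauchy (fun=> x).
Proof. by move=> e e0; exists 0%N => m n _ _; rewrite subrr snorm0. Qed.

Definition mk_cauchy u (uc : scauchy u) : scauchy_seq := CauchySeq (asboolT uc).

Lemma scauchy_seqP (u : scauchy_seq) : scauchy u.
Proof. exact: asboolW (scauchyP u). Qed.

Definition completion_eqv (u v : scauchy_seq) : bool :=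
  `[< snull (fun n => u n - v n) >].

Let completion_eqv_refl : reflexive completion_eqv.
Proof.
by move=> u; apply/asboolP; apply: snull_ext snull0 => n; rewrite subrr.
Qed.

Let completion_eqv_sym : symmetric completion_eqv.
Proof.
by move=> u v; apply/asboolP/asboolP => /snullN;
  apply: snull_ext => n; rewrite opprB.
Qed.

Let completion_eqv_trans : transitive completion_eqv.
Proof.
move=> v u w /asboolP uv /asboolP vw; apply/asboolP.
by apply: snull_ext (snullD uv vw) => n; rewrite addrA subrK.
Qed.

Canonical completion_equiv := EquivRel completion_eqv
  completion_eqv_refl completion_eqv_sym completion_eqv_trans.

Definition completion := {eq_quot completion_equiv}.

HB.instance Definition _ := Quotient.on completion.
HB.instance Definition _ := Choice.on completion.
HB.instance Definition _ := EqQuotient.on completion.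

Implicit Types x y z : completion.

Definition climit u (uc : scauchy u) : completion := \pi_completion (mk_cauchy uc).

Lemma climit_eq u v (uc : scauchy u) (vc : scauchy v) :
  climit uc = climit vc <-> snull (fun n => u n - v n).
Proof.
split; first by move=> /eqmodP/asboolP.
by move=> uv; apply/eqmodP/asboolP.
Qed.

Lemma climit_repr x : climit (scauchy_seqP (repr x)) = x.
Proof.
rewrite -[RHS]reprK /climit; congr (\pi_completion _).
exact: val_inj.
Qed.

Lemma climit_ind (P : completion -> Prop) :
  (forall u (uc : scauchy u), P (climit uc)) -> forall x, P x.
Proof. by move=> Pc x; rewrite -(climit_repr x). Qed.

Let czero : completion := climit (scauchy_cst 0).
Let cadd x y : completion :=
  climit (scauchyD (scauchy_seqP (repr x)) (scauchy_seqP (repr y))).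
Let cscale (c : R[i]) x : completion :=
  climit (scauchyZ c (scauchy_seqP (repr x))).
Let copp := cscale (-1).

Let repr_climit u (uc : scauchy u) : snull (fun n => repr (climit uc) n - u n).
Proof. exact: (climit_eq (scauchy_seqP _) uc).1 (climit_repr _). Qed.

Let caddE u v (uc : scauchy u) (vc : scauchy v) :
  cadd (climit uc) (climit vc) = climit (scauchyD uc vc).
Proof.
apply/climit_eq; apply: snull_ext (snullD (repr_climit uc) (repr_climit vc)).
by move=> n; rewrite opprD addrACA.
Qed.

Let cscaleE c u (uc : scauchy u) :
  cscale c (climit uc) = climit (scauchyZ c uc).
Proof.
apply/climit_eq; apply: snull_ext (snullZ c (repr_climit uc)) => n.
by rewrite scalerBr.
Qed.

Let climit_ext u v (uc : scauchy u) (vc : scauchy v) :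
  u =1 v -> climit uc = climit vc.
Proof.
by move=> uv; apply/climit_eq; apply: snull_ext snull0 => n; rewrite uv subrr.
Qed.

Let caddA : associative cadd.
Proof.
elim/climit_ind => u uc; elim/climit_ind => v vc; elim/climit_ind => w wc.
by rewrite !caddE; apply: climit_ext => n; rewrite addrA.
Qed.
Let caddC : commutative cadd.
Proof.
elim/climit_ind => u uc; elim/climit_ind => v vc.
by rewrite !caddE; apply: climit_ext => n; rewrite addrC.
Qed.
Let cadd0 : left_id czero cadd.
Proof.
by elim/climit_ind => u uc; rewrite caddE; apply: climit_ext => n; rewrite add0r.
Qed.
Let caddN : left_inverse czero copp cadd.
Proof.
elim/climit_ind => u uc; rewrite /copp cscaleE caddE; apply: climit_ext => n.
by rewrite scaleN1r addNr.
Qed.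

HB.instance Definition _ := GRing.isZmodule.Build completion caddA caddC cadd0 caddN.

Let cscaleA a b x : cscale a (cscale b x) = cscale (a * b) x.
Proof.
elim/climit_ind: x => u uc; rewrite !cscaleE; apply: climit_ext => n.
by rewrite scalerA.
Qed.
Let cscale1 : left_id 1 cscale.
Proof.
elim/climit_ind => u uc; rewrite cscaleE; apply: climit_ext => n.
by rewrite scale1r.
Qed.
Let cscaleDr : right_distributive cscale +%R.
Proof.
move=> c; elim/climit_ind => u uc; elim/climit_ind => v vc.
rewrite -[_ + climit _]/(cadd _ _) -[RHS]/(cadd _ _) !(caddE, cscaleE).
by apply: climit_ext => n; rewrite scalerDr.
Qed.
Let cscaleDl x : {morph cscale^~ x : a b / a + b}.
Proof.
move=> a b; elim/climit_ind: x => u uc.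
rewrite -[RHS]/(cadd _ _) !(caddE, cscaleE).
by apply: climit_ext => n; rewrite scalerDl.
Qed.

HB.instance Definition _ := GRing.Zmodule_isLmodule.Build R[i] completion
  cscaleA cscale1 cscaleDr cscaleDl.

Lemma climitD u v (uc : scauchy u) (vc : scauchy v) :
  climit uc + climit vc = climit (scauchyD uc vc).
Proof. exact: caddE. Qed.

Lemma climitZ c u (uc : scauchy u) : c *: climit uc = climit (scauchyZ c uc).
Proof. exact: cscaleE. Qed.

Lemma climitB u v (uc : scauchy u) (vc : scauchy v) (uvc : scauchy (u \- v)) :
  climit uc - climit vc = climit uvc.
Proof.
rewrite -scaleN1r climitZ climitD; apply: climit_ext => n.
by rewrite scaleN1r.
Qed.

Definition completion_norm x : R := limn (fun n => p (repr x n)).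

Let scauchy_cvgn u : scauchy u -> cvgn (fun n => p (u n)).
Proof.
move=> uc; apply: cauchy_cvg; apply/cauchyP => e e0.
have [N hN] := uc _ e0; exists (p (u N)); exists N => // n /= Nn.
rewrite -ball_normE /ball_/=.
have H (x y : V) : p x - p y <= p (x - y).
  by rewrite lerBlDr (le_trans _ (snormD _ _ _))// subrK.
rewrite (le_lt_trans _ (hN N n (leqnn _) Nn))// ler_norml H andbT.
by rewrite lerNl opprB sdistC H.
Qed.

Let snull_limn u v : scauchy v -> snull (fun n => u n - v n) ->
  limn (fun n => p (u n)) = limn (fun n => p (v n)).
Proof.
move=> vc uv; apply/cvg_lim => //.
have H (x y : V) : p x - p y <= p (x - y).
  by rewrite lerBlDr (le_trans _ (snormD _ _ _))// subrK.
rewrite -[limn _]addr0.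
have -> : (fun n => p (u n)) = (fun n => p (v n)) \+ (fun n => p (u n) - p (v n)).
  by apply/funext => n /=; rewrite addrC subrK.
apply: cvgD; first exact: scauchy_cvgn.
apply/cvgrPdist_lt => e e0; have [N hN] := uv _ e0; exists N => // n /= Nn.
rewrite sub0r normrN (le_lt_trans _ (hN n Nn))// ler_norml H andbT.
by rewrite lerNl opprB sdistC H.
Qed.

Lemma climit_norm u (uc : scauchy u) :
  completion_norm (climit uc) = limn (fun n => p (u n)).
Proof. exact: snull_limn (repr_climit uc). Qed.

Let norm_val x : R[i] := (completion_norm x)%:C.

Let completion_normD x y : norm_val (x + y) <= norm_val x + norm_val y.
Proof.
elim/climit_ind: x => u uc; elim/climit_ind: y => v vc.
rewrite /norm_val -rmorphD lecR climitD !climit_norm -limD; try exact: scauchy_cvgn.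
apply: ler_lim.
- exact: scauchy_cvgn (scauchyD uc vc).
- by apply: is_cvgD; exact: scauchy_cvgn.
- by exists 0%N => // n _ /=; exact: snormD.
Qed.

Let completion_normZ c x : norm_val (c *: x) = `|c| * norm_val x.
Proof.
elim/climit_ind: x => u uc.
rewrite /norm_val [in RHS](@ge0_ReE _ `|c|)// -rmorphM; congr (_%:C).
rewrite climitZ !climit_norm; under eq_fun do rewrite snormZ.
apply/cvg_lim => //; apply: cvgM; first exact: cvg_cst.
exact: scauchy_cvgn.
Qed.

Let completion_norm0 x : norm_val x = 0 -> x = 0.
Proof.
elim/climit_ind: x => u uc /complexI; rewrite climit_norm => u0.
apply/climit_eq => e e0.
have /cvgrPdist_lt/(_ _ e0)[N _ hN] : (fun n => p (u n)) @ \oo --> 0.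
  by rewrite -u0; exact: scauchy_cvgn.
exists N => n Nn; have := hN n Nn; rewrite /= sub0r normrN subr0.
by rewrite ger0_norm// snorm_ge0.
Qed.

HB.instance Definition _ := Lmodule_isNormed.Build R[i] completion
  completion_normD completion_normZ completion_norm0.

Definition cembed (v : V) : completion := climit (scauchy_cst v).

Lemma cembed_linear : linear cembed.
Proof.
by move=> c u v; rewrite /cembed climitZ climitD; exact: climit_ext.
Qed.

HB.instance Definition _ :=
  GRing.isLinear.Build R[i] V completion _ cembed cembed_linear.

Lemma rnorm_climit u (uc : scauchy u) : rnorm (climit uc) = limn (fun n => p (u n)).
Proof. exact: climit_norm. Qed.

Lemma rnorm_cembed (v : V) : rnorm (cembed v) = p v.
Proof. by rewrite rnorm_climit lim_cst. Qed.

Lemma cembed_lim u (uc : scauchy u) : seq_lim (fun n => cembed (u n)) (climit uc).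
Proof.
move=> e e0; have [N hN] := uc _ (divr_gt0 e0 (ltr0n _ 2)).
exists N => n Nn.
have dc : scauchy (fun m => u n - u m).
  have := scauchyD (scauchy_cst (u n)) (scauchyZ (-1) uc).
  by under eq_fun do rewrite scaleN1r.
rewrite /cembed (climitB _ uc dc) rnorm_climit (@le_lt_trans _ _ (e / 2))//; last first.
  by rewrite ltr_pdivrMr// ltr_pMr// ltr1n.
apply: limr_le; first exact: scauchy_cvgn.
by exists N => // m /= Nm; rewrite ltW//; exact: hN.
Qed.

Lemma cembed_dense x (e : R) : 0 < e -> exists v : V, rnorm (cembed v - x) < e.
Proof.
elim/climit_ind: x => u uc /(cembed_lim uc)[N hN].
by exists (u N); exact: hN.
Qed.

Let completion_complete (F : set_system completion) :
  ProperFilter F -> cauchy F -> cvg F.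
Proof.
apply: seq_complete => x xc.
have /choice[v xv] : forall n : nat, exists v : V, rnorm (cembed v - x n) < n.+1%:R^-1.
  by move=> n; apply: cembed_dense; rewrite invr_gt0.
have vc : scauchy v.
  move=> e e0; have e40 : 0 < e / 2 / 2 by rewrite !divr_gt0.
  have [N hN] := invS_lt e40.
  have [N' hN'] := xc _ (divr_gt0 e0 (ltr0n _ 2)).
  exists (maxn N N') => m n; rewrite !geq_max => /andP[Nm N'm] /andP[Nn N'n].
  rewrite -rnorm_cembed linearB (le_lt_trans (rdist_tri _ (x m) _))//.
  rewrite (le_lt_trans (lerD (lexx _) (rdist_tri _ (x n) _)))//.
  rewrite addrCA (splitr e) ltrD//; first exact: hN'.
  rewrite (splitr (e / 2)) ltrD//.
    by rewrite (lt_trans (xv m))// hN.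
  by rewrite rdistC (lt_trans (xv n))// hN.
exists (climit vc) => e e0; have e20 : 0 < e / 2 by rewrite !divr_gt0.
have [N hN] := invS_lt e20; have [N' hN'] := cembed_lim vc e20.
exists (maxn N N') => n; rewrite geq_max => /andP[Nn N'n].
rewrite (le_lt_trans (rdist_tri _ (cembed (v n)) _))// (splitr e) ltrD ?hN'//.
by rewrite rdistC (lt_trans (xv n))// hN.
Qed.

HB.instance Definition _ := Uniform_isComplete.Build completion completion_complete.

End Def.


End Completion.

Section Extension.
Context {R : realType}.

Lemma seq_limP (V : normedModType R[i]) (u : nat -> V) (l : V) :
  seq_lim u l <-> u @ \oo --> l.
Proof.
split=> [ul|ul e e0].
  apply/cvgrPdist_lt => e e0.
  have e1 : 0 < complex.Re e by move: e0; rewrite ltcE /= => /andP[].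
  have eE : e = (complex.Re e)%:C by apply: ge0_ReE; exact: ltW.
  have [N hN] := ul _ e1; exists N => // n /= Nn.
  by rewrite eE rnormE ltcR rdistC; exact: hN.
move/cvgrPdist_lt : ul => /(_ e%:C); rewrite ltcR => /(_ e0)[N _ hN].
by exists N => n Nn; have := hN n Nn; rewrite /= rnormE ltcR rdistC.
Qed.

Variables (V : lmodType R[i]) (p : seminorm V) (G : completeNormedModType R[i]).

Definition cextend (f : V -> G) (x : completion p) : G :=
  lim (f (repr x n) @[n --> \oo]).

Section Bounded.
Variables (f : V -> G) (M : R).
Hypotheses (fl : linear f) (M0 : 0 <= M) (fM : forall v, rnorm (f v) <= M * p v).

Let f' : {linear V -> G} := HB.pack f (GRing.isLinear.Build R[i] V G _ f fl).

Let fB x y : f (x - y) = f x - f y. Proof. exact: (raddfB f'). Qed.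

Let M1 : 0 < M + 1. Proof. by rewrite ltr_wpDl. Qed.

Let fM1 v : rnorm (f v) <= (M + 1) * p v.
Proof. by rewrite (le_trans (fM v))// ler_wpM2r ?snorm_ge0// lerDl. Qed.

Let cextend_repr (x : completion p) : seq_lim (fun n => f (repr x n)) (cextend f x).
Proof.
have [|l hl] := @complete_seq R G (fun n => f (repr x n)).
  move=> e e0; have [N hN] := scauchy_seqP (repr x) (divr_gt0 e0 M1).
  exists N => m n Nm Nn; rewrite -fB (le_lt_trans (fM1 _))//.
  by rewrite mulrC -ltr_pdivlMr//; exact: hN.
suff -> : cextend f x = l by [].
by apply/cvg_lim; [exact: norm_hausdorff|exact/seq_limP].
Qed.

Lemma cextend_climit u (uc : scauchy p u) :
  seq_lim (fun n => f (u n)) (cextend f (climit uc)).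
Proof.
move=> e e0; have e20 : 0 < e / 2 by rewrite divr_gt0.
have /climit_eq un : climit uc = climit (scauchy_seqP (repr (climit uc))).
  by rewrite climit_repr.
have [N hN] := un _ (divr_gt0 e20 M1).
have [N' hN'] := cextend_repr (climit uc) e20.
exists (maxn N N') => n; rewrite geq_max => /andP[Nn N'n].
rewrite (le_lt_trans (rdist_tri _ (f (repr (climit uc) n)) _))//.
rewrite (splitr e) ltrD//; last exact: hN'.
rewrite -fB (le_lt_trans (fM1 _))// mulrC -ltr_pdivlMr//; exact: hN.
Qed.

Lemma cextend_cembed (v : V) : cextend f (cembed p v) = f v.
Proof.
apply: (seq_lim_unique (cextend_climit (scauchy_cst p v))).
by move=> e e0; exists 0%N => n _; rewrite subrr rnorm0.
Qed.

Let cextend_linear : linear (cextend f).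
Proof.
move=> c x y; rewrite -(climit_repr x) -(climit_repr y).
set uc := scauchy_seqP _; set vc := scauchy_seqP _.
move: (cseq_val _) uc (cseq_val _) vc => u uc v vc.
rewrite climitZ climitD; apply: (seq_lim_unique (cextend_climit _)).
apply/seq_limP; have -> : (fun n => f (c *: u n + v n)) =
  (fun n => c *: f (u n)) \+ (fun n => f (v n)) by apply/funext => n; exact: fl.
apply: cvgD; last by apply/seq_limP; exact: cextend_climit.
by apply: cvgZr; apply/seq_limP; exact: cextend_climit.
Qed.

Let cextend_bound (x : completion p) : rnorm (cextend f x) <= M * rnorm x.
Proof.
rewrite -(climit_repr x); set uc := scauchy_seqP _; move: (cseq_val _) uc => u uc.
apply/ler_addgt0Pr => e e0.
have d0 : 0 < e / (M + 1) by rewrite divr_gt0.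
have [N hN] := cextend_climit uc d0.
have [N' hN'] := cembed_lim uc d0.
pose n := maxn N N'.
have h1 := hN n (leq_maxl _ _); have h2 := hN' n (leq_maxr _ _).
rewrite -[X in rnorm X](subrK (f (u n))) (le_trans (rnormD _ _))// rdistC.
have h3 : rnorm (f (u n)) <= M * (rnorm (climit uc) + e / (M + 1)).
  rewrite (le_trans (fM _))// ler_wpM2l// -rnorm_cembed.
  rewrite -[X in rnorm X](subrK (climit uc)) (le_trans (rnormD _ _))//.
  by rewrite addrC lerD2l ltW.
rewrite (le_trans (lerD (ltW h1) h3))// mulrDr addrCA lerD2l.
rewrite -{1}[e / (M + 1)]mul1r -mulrDl addrC mulrCA divff ?mulr1//.
by rewrite gt_eqF.
Qed.

Definition cextend_blin : blin (completion p) G :=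
  mk_blin cextend_linear cextend_bound.

Lemma cextend_opnorm : opnorm cextend_blin <= M.
Proof. apply: opnorm_le => // x; exact: cextend_bound. Qed.

End Bounded.

Lemma completion_blin_ext (g h : blin (completion p) G) :
  (forall v, g (cembed p v) = h (cembed p v)) -> g = h.
Proof.
move=> gh; apply: blin_ext => x; apply/subr0_eq; rewrite -blinBE.
apply: eq0_rnorm_small => e e0.
have M1 : 0 < opnorm (g - h) + 1 by rewrite ltr_wpDl// opnorm_ge0.
have [v xv] := cembed_dense x (divr_gt0 e0 M1).
have -> : (g - h) x = (g - h) (x - cembed p v).
  have gh0 : (g - h) (cembed p v) = 0 by rewrite blinBE gh subrr.
  have gB : (g - h) (x - cembed p v) = (g - h) x - (g - h) (cembed p v) := raddfB (g - h) _ _.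
  by rewrite gB gh0 subr0.
rewrite (le_trans (opnormP _ _))// rdistC.
rewrite (@le_trans _ _ ((opnorm (g - h) + 1) * rnorm (cembed p v - x)))//.
  by rewrite ler_wpM2r ?rnorm_ge0// lerDl.
by rewrite mulrC -ler_pdivlMr// ltW.
Qed.

End Extension.

Section ProjectiveTensor.
Context {R : realType}.

Definition ptensor (E F : normedModType R[i]) : Type :=
  completion (proj_seminorm E F).

HB.instance Definition _ E F := CompleteNormedModule.copy (ptensor E F)
  (completion (proj_seminorm E F)).

Record bbilin (E F G : normedModType R[i]) := BBilin {
  bbilin_fun :> E -> F -> G;
  bbilin_bilinear : bilinear_map bbilin_fun;
  bbilin_bounded : exists2 M : R, 0 <= M &
    forall x y, rnorm (bbilin_fun x y) <= M * (rnorm x * rnorm y) }.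

Definition ptens (E F : normedModType R[i]) (x : E) (y : F) : ptensor E F :=
  cembed (proj_seminorm E F) (tens x y).

Section Theory.
Variables E F : normedModType R[i].

Lemma ptens_bilinear : bilinear_map (@ptens E F).
Proof.
have [tl tr] := tens_bilinear E F.
split=> [y c x x'|x c y y']; rewrite /ptens.
  by have := tl y c x x' => /= ->; exact: cembed_linear.
by have := tr x c y y' => /= ->; exact: cembed_linear.
Qed.

Lemma ptens_norm x y : rnorm (@ptens E F x y) <= rnorm x * rnorm y.
Proof.
rewrite rnorm_cembed /= (le_trans (@proj_norm_le _ _ _ _ [:: (x, y)] _))//.
  by rewrite big_seq1.
by rewrite big_seq1.
Qed.

Variable G : completeNormedModType R[i].

Let tlift_bound (f : E -> F -> G) (M : R) : bilinear_map f -> 0 <= M ->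
  (forall x y, rnorm (f x y) <= M * (rnorm x * rnorm y)) ->
  forall u : tensor E F, rnorm (tlift f u) <= M * proj_seminorm E F u.
Proof.
move=> fb M0 fM u; apply/ler_addgt0Pr => e e0.
have M1 : 0 < M + 1 by rewrite ltr_wpDl.
have [|s us sE] := @proj_norm_lt R E F u (proj_norm u + e / (M + 1)).
  by rewrite ltrDl divr_gt0.
rewrite [in leLHS]us tlift_sum// (@le_trans _ _ (M * (proj_norm u + e / (M + 1))))//.
  rewrite (le_trans _ (ler_wpM2l M0 (ltW sE)))// /tsum mulr_sumr.
  elim/big_ind2 : _ => [|x1 x2 y1 y2 h1 h2|i _]; [by rewrite rnorm0| |exact: fM].
  by rewrite (le_trans (rnormD _ _))// lerD.
rewrite mulrDr lerD2l mulrCA ger_pMr// ler_pdivrMr// mul1r lerDl//.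
Qed.

Let ptlift_is_blin (f : bbilin E F G) :
  (cextend (p := proj_seminorm E F) (tlift f) : ptensor E F -> G) \in
    @is_blin R (ptensor E F) G.
Proof.
have fb := bbilin_bilinear f; have [M M0 fM] := bbilin_bounded f.
exact: blinP (cextend_blin (tlift_linear fb) M0 (tlift_bound fb M0 fM)).
Qed.

Definition ptlift (f : bbilin E F G) : blin (ptensor E F) G :=
  Blin (ptlift_is_blin f).

Lemma ptliftE (f : bbilin E F G) x y : ptlift f (ptens x y) = f x y.
Proof.
have fb := bbilin_bilinear f; have [M M0 fM] := bbilin_bounded f.
rewrite /= (cextend_cembed (tlift_linear fb) M0 (tlift_bound fb M0 fM)).
exact: tliftE.
Qed.

Lemma ptlift_opnorm (f : bbilin E F G) (M : R) : 0 <= M ->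
  (forall x y, rnorm (f x y) <= M * (rnorm x * rnorm y)) ->
  opnorm (ptlift f) <= M.
Proof.
move=> M0 fM; have fb := bbilin_bilinear f.
exact: cextend_opnorm (tlift_linear fb) M0 (tlift_bound fb M0 fM).
Qed.

Lemma ptensor_ext (g h : blin (ptensor E F) G) :
  (forall x y, g (ptens x y) = h (ptens x y)) -> g = h.
Proof.
move=> gh; apply: (@completion_blin_ext R _ (proj_seminorm E F)) => v.
have [s ->] := tensorP v.
rewrite -[cembed _ _]/(cembed (proj_seminorm E F) _ : ptensor E F).
rewrite (raddf_sum (cembed (proj_seminorm E F))).
rewrite (raddf_sum g) (raddf_sum h).
by apply: eq_bigr => p _; exact: gh.
Qed.

End Theory.
End ProjectiveTensor.

Section Dual.
Context {R : realType}.

Definition dual_space (E : normedModType R[i]) : Type := blin E R[i].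

HB.instance Definition _ E := CompleteNormedModule.copy (dual_space E) (blin E R[i]).

Variables E F : normedModType R[i].

Let transpose_is_blin (T : blin E F) (f : dual_space F) :
  f \o T \in @is_blin R E R[i].
Proof.
apply/asboolP; split => [c x y|x] /=; first by rewrite !linearP.
by apply: continuous_comp; exact: blin_continuous.
Qed.

Definition transpose_fun (T : blin E F) (f : dual_space F) : dual_space E :=
  Blin (transpose_is_blin T f).

Let transpose_linear T : linear (transpose_fun T).
Proof. by move=> c f g; apply: blin_ext. Qed.

Let transpose_bound T f : rnorm (transpose_fun T f) <= opnorm T * rnorm f.
Proof.
apply: opnorm_le; first by rewrite mulr_ge0 ?opnorm_ge0.
move=> x; rewrite (le_trans (opnormP f _))// [opnorm T * _]mulrC -mulrA.
by rewrite ler_wpM2l ?opnorm_ge0// opnormP.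
Qed.

Definition transpose (T : blin E F) : blin (dual_space F) (dual_space E) :=
  mk_blin (transpose_linear T) (transpose_bound T).

Lemma transposeE T f x : transpose T f x = f (T x). Proof. by []. Qed.

Let bidual_eval_linear (x : E) : linear (fun f : dual_space E => f x).
Proof. by move=> c f g. Qed.

Let bidual_eval_bound (x : E) (f : dual_space E) :
  rnorm (f x) <= rnorm x * rnorm f.
Proof. by rewrite mulrC; exact: opnormP. Qed.

Definition bidual_embed (x : E) : dual_space (dual_space E) :=
  mk_blin (bidual_eval_linear x) (bidual_eval_bound x).

Lemma bidual_embedE x f : bidual_embed x f = f x. Proof. by []. Qed.

End Dual.

Notation bidual E := (dual_space (dual_space E)).
Notation bitranspose T := (transpose (transpose T)).

HB.mixin Record isBanachAlgebra (K : numFieldType) A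
    & CompleteNormedModule K A := {
  bmul : A -> A -> A ;
  bmulA : associative bmul ;
  bmul_bilinear : bilinear_map bmul ;
  bmul_norm : forall a b, `|bmul a b| <= `|a| * `|b|
}.

#[short(type="banachAlgType")]
HB.structure Definition BanachAlgebra (K : numFieldType) :=
  {A of CompleteNormedModule K A & isBanachAlgebra K A}.

Section BanachAlgebraTheory.
Context {K : numFieldType} {A : banachAlgType K}.

Lemma bmulDl (a b c : A) : bmul (a + b) c = bmul a c + bmul b c.
Proof. by have := (@bmul_bilinear _ A).1 c 1 a b; rewrite /= !scale1r. Qed.
Lemma bmulDr (a b c : A) : bmul a (b + c) = bmul a b + bmul a c.
Proof. by have := (@bmul_bilinear _ A).2 a 1 b c; rewrite /= !scale1r. Qed.
Lemma bmul0l (a : A) : bmul 0 a = 0.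
Proof. by apply: (addrI (bmul 0 a)); rewrite -bmulDl !addr0. Qed.
Lemma bmul0r (a : A) : bmul a 0 = 0.
Proof. by apply: (addrI (bmul a 0)); rewrite -bmulDr !addr0. Qed.
Lemma bmulZl (k : K) (a b : A) : bmul (k *: a) b = k *: bmul a b.
Proof.
by have := (@bmul_bilinear _ A).1 b k a 0; rewrite /= bmul0l !addr0.
Qed.
Lemma bmulZr (k : K) (a b : A) : bmul a (k *: b) = k *: bmul a b.
Proof.
by have := (@bmul_bilinear _ A).2 a k b 0; rewrite /= bmul0r !addr0.
Qed.

End BanachAlgebraTheory.

(* The actions are jointly continuous, i.e. bounded by some constant, which need
   not be 1. [A] may have no unit, so no unitality is required. *)
HB.mixin Record isBanachBimodule (K : numFieldType) (A : banachAlgType K) X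
    & CompleteNormedModule K X := {
  lact : A -> X -> X ;
  ract : X -> A -> X ;
  lact_bilinear : bilinear_map lact ;
  ract_bilinear : bilinear_map ract ;
  lactM : forall a b x, lact (bmul a b) x = lact a (lact b x) ;
  ractM : forall x a b, ract x (bmul a b) = ract (ract x a) b ;
  lact_ract : forall a x b, ract (lact a x) b = lact a (ract x b) ;
  lact_bounded : exists2 M : K, 0 <= M &
    forall a x, `|lact a x| <= M * (`|a| * `|x|) ;
  ract_bounded : exists2 M : K, 0 <= M &
    forall x a, `|ract x a| <= M * (`|x| * `|a|)
}.

#[short(type="banachBimodType")]
HB.structure Definition BanachBimodule (K : numFieldType) (A : banachAlgType K) :=
  {X of CompleteNormedModule K X & isBanachBimodule K A X}.

Section DualBimodule.
Context {R : realType}.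
Variables (A : banachAlgType R[i]) (X : banachBimodType A).

Let bounded_rnorm (U V W : normedModType R[i]) (f : U -> V -> W) :
  (exists2 M : R[i], 0 <= M & forall a x, `|f a x| <= M * (`|a| * `|x|)) ->
  exists2 M : R, 0 <= M & forall a x, rnorm (f a x) <= M * (rnorm a * rnorm x).
Proof.
move=> [M M0 fM]; have ME := ge0_ReE M0; exists (complex.Re M).
  by rewrite -ler0c -ME.
by move=> a x; have := fM a x; rewrite [X in X * _]ME !rnormE -!rmorphM lecR.
Qed.

Lemma lact_rnorm : exists2 M : R, 0 <= M &
  forall (a : A) (x : X), rnorm (lact a x) <= M * (rnorm a * rnorm x).
Proof. exact/bounded_rnorm/lact_bounded. Qed.

Lemma ract_rnorm : exists2 M : R, 0 <= M &
  forall (x : X) (a : A), rnorm (ract x a) <= M * (rnorm x * rnorm a).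
Proof. exact/bounded_rnorm/ract_bounded. Qed.

Let lact_is_blin (a : A) : lact a \in @is_blin R X X.
Proof.
have [M M0 hM] := lact_rnorm.
apply: (@bounded_is_blin _ _ _ _ (M * rnorm a)).
  by move=> c x y; exact: ((@lact_bilinear _ A X).2 a).
by move=> x; rewrite -mulrA.
Qed.

Let ract_is_blin (a : A) : ract^~ a \in @is_blin R X X.
Proof.
have [M M0 hM] := ract_rnorm.
apply: (@bounded_is_blin _ _ _ _ (M * rnorm a)).
  by move=> c x y; exact: ((@ract_bilinear _ A X).1 a).
by move=> x; rewrite -mulrA [rnorm a * _]mulrC.
Qed.

Definition lact_blin (a : A) : blin X X := Blin (lact_is_blin a).
Definition ract_blin (a : A) : blin X X := Blin (ract_is_blin a).

(* [transpose (ract_blin a) f] is [x |-> f (ract x a)]: the left action on the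
   dual comes from the right action on the module, and conversely. *)
Definition dual_lact (a : A) (f : dual_space X) : dual_space X :=
  transpose (ract_blin a) f.
Definition dual_ract (f : dual_space X) (a : A) : dual_space X :=
  transpose (lact_blin a) f.

Lemma dual_lactE a f x : dual_lact a f x = f (ract x a). Proof. by []. Qed.
Lemma dual_ractE f a x : dual_ract f a x = f (lact a x). Proof. by []. Qed.

Let dual_lact_bilinear : bilinear_map dual_lact.
Proof.
split=> [f c a b|a c f g]; apply: blin_ext => x //=.
have := (@ract_bilinear _ A X).2 x c a b => /= ->; exact: linearP.
Qed.

Let dual_ract_bilinear : bilinear_map dual_ract.
Proof.
split=> [a c f g|f c a b]; apply: blin_ext => x //=.
have := (@lact_bilinear _ A X).1 x c a b => /= ->; exact: linearP.
Qed.

Let dual_lactM a b f : dual_lact (bmul a b) f = dual_lact a (dual_lact b f).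
Proof. by apply: blin_ext => x /=; rewrite ractM. Qed.

Let dual_ractM f a b : dual_ract f (bmul a b) = dual_ract (dual_ract f a) b.
Proof. by apply: blin_ext => x /=; rewrite lactM. Qed.

Let dual_lact_ract a f b :
  dual_ract (dual_lact a f) b = dual_lact a (dual_ract f b).
Proof. by apply: blin_ext => x /=; rewrite lact_ract. Qed.

Let dual_lact_bounded : exists2 M : R[i], 0 <= M &
  forall a f, `|dual_lact a f| <= M * (`|a| * `|f|).
Proof.
have [M M0 hM] := ract_rnorm; exists M%:C => [|a f]; first by rewrite ler0c.
rewrite !rnormE -!rmorphM lecR; apply: opnorm_le.
  by rewrite !mulr_ge0 ?rnorm_ge0.
move=> x; rewrite dual_lactE (le_trans (opnormP f _))//.
rewrite [M * _]mulrA [leRHS]mulrAC [leRHS]mulrC ler_wpM2l ?opnorm_ge0//.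
by rewrite (le_trans (hM _ _))// -mulrA [rnorm a * _]mulrC.
Qed.

Let dual_ract_bounded : exists2 M : R[i], 0 <= M &
  forall f a, `|dual_ract f a| <= M * (`|f| * `|a|).
Proof.
have [M M0 hM] := lact_rnorm; exists M%:C => [|f a]; first by rewrite ler0c.
rewrite !rnormE -!rmorphM lecR; apply: opnorm_le.
  by rewrite !mulr_ge0 ?rnorm_ge0.
move=> x; rewrite dual_ractE (le_trans (opnormP f _))//.
rewrite mulrCA -[leRHS]mulrA ler_wpM2l ?opnorm_ge0//.
by rewrite (le_trans (hM _ _))// mulrA.
Qed.

HB.instance Definition _ := isBanachBimodule.Build R[i] A (dual_space X)
  dual_lact_bilinear dual_ract_bilinear dual_lactM dual_ractM dual_lact_ract
  dual_lact_bounded dual_ract_bounded.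

End DualBimodule.

Definition amenable (R : realType) (A : banachAlgType R[i]) : Prop :=
  forall (X : banachBimodType A) (D : A -> dual_space X),
    linear D -> continuous D ->
    (forall a b, D (bmul a b) = lact a (D b) + ract (D a) b) ->
    exists x : dual_space X, forall a, D a = lact a x - ract x a.

(* [(a, c)] stands for [a + c 1_+]. The norm is [|a| + |c|], not the max norm of the product (which is not
   submultiplicative): hence a separate type. *)
Section Unitization.
Context {R : realType}.

Definition unitization (A : banachAlgType R[i]) : Type := (A * R[i])%type.

Variable A : banachAlgType R[i].
Local Notation Aplus := (unitization A).

HB.instance Definition _ := GRing.Lmodule.copy Aplus (A * R[i])%type.

Let unorm (x : Aplus) : R[i] := `|x.1| + `|x.2|.

Let unormD x y : unorm (x + y) <= unorm x + unorm y.
Proof. by rewrite /unorm addrACA lerD// ler_normD. Qed.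
Let unormZ (c : R[i]) x : unorm (c *: x) = `|c| * unorm x.
Proof. by rewrite /unorm mulrDr /= normrZ normrM. Qed.
Let unorm0 x : unorm x = 0 -> x = 0.
Proof.
case: x => a c /eqP; rewrite /unorm paddr_eq0//= !normr_eq0.
by move=> /andP[/eqP -> /eqP ->].
Qed.

HB.instance Definition _ := Lmodule_isNormed.Build R[i] Aplus unormD unormZ unorm0.

Lemma unitization_rnorm (x : Aplus) : rnorm x = rnorm x.1 + rnorm x.2.
Proof. by apply: complexI; rewrite rmorphD /= -!rnormE. Qed.

Let unitization_complete (F : set_system Aplus) :
  ProperFilter F -> cauchy F -> cvg F.
Proof.
apply: seq_complete => u uc.
have [e e0|a ua] := @complete_seq R A (fun n => (u n).1).
  have [N hN] := uc _ e0; exists N => m n hm hn.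
  by rewrite (le_lt_trans _ (hN m n hm hn))// unitization_rnorm lerDl rnorm_ge0.
have [e e0|b ub] := @complete_seq R R[i] (fun n => (u n).2).
  have [N hN] := uc _ e0; exists N => m n hm hn.
  by rewrite (le_lt_trans _ (hN m n hm hn))// unitization_rnorm lerDr rnorm_ge0.
exists ((a, b) : Aplus) => e e0.
have [N hN] := ua _ (divr_gt0 e0 (ltr0n _ 2)).
have [N' hN'] := ub _ (divr_gt0 e0 (ltr0n _ 2)).
exists (maxn N N') => n; rewrite geq_max => /andP[Nn N'n].
by rewrite unitization_rnorm (splitr e) ltrD ?hN ?hN'.
Qed.

HB.instance Definition _ := Uniform_isComplete.Build Aplus unitization_complete.

Definition unitization_mul (x y : Aplus) : Aplus :=
  (bmul x.1 y.1 + x.2 *: y.1 + y.2 *: x.1, x.2 * y.2).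

Definition unitization_one : Aplus := (0, 1).

Let unitization_mulA : associative unitization_mul.
Proof.
move=> [a k] [b l] [c m]; rewrite /unitization_mul /=; congr (_, _).
  rewrite !(bmulDl, bmulDr, bmulZl, bmulZr) !scalerDr !scalerA bmulA.
  rewrite -!addrA; congr (_ + _); rewrite [m * k]mulrC [m * l]mulrC.
  rewrite [RHS]addrCA; congr (_ + _).
  by rewrite addrCA; congr (_ + _); rewrite addrCA.
by rewrite mulrA.
Qed.

Let unitization_bilinear : bilinear_map unitization_mul.
Proof.
split=> [z c x y|z c x y]; congr (_, _) => /=.
- rewrite bmulDl bmulZl scalerDl !scalerDr !scalerA [c * z.2]mulrC.
  by rewrite [RHS]addrACA [X in _ = X + _]addrACA.
- by rewrite mulrDl scalerAl.
- rewrite bmulDr bmulZr scalerDl !scalerDr !scalerA [c * z.2]mulrC.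
  by rewrite [RHS]addrACA [X in _ = X + _]addrACA.
- by rewrite mulrDr -[z.2 * (c *: _)]/(z.2 * (c * _)) mulrCA.
Qed.

Let unitization_norm (x y : Aplus) : `|unitization_mul x y| <= `|x| * `|y|.
Proof.
rewrite -[leLHS]/(`|_| + `|_|) -[`|x|]/(`|_| + `|_|) -[`|y|]/(`|_| + `|_|) /=.
rewrite normrM mulrDl !mulrDr [leRHS]addrA lerD2r.
rewrite (le_trans (ler_normD _ _))// normrZ [`|y.2| * _]mulrC.
rewrite [leRHS]addrAC lerD2r.
by rewrite (le_trans (ler_normD _ _))// normrZ lerD2r bmul_norm.
Qed.

HB.instance Definition _ := isBanachAlgebra.Build R[i] Aplus
  unitization_mulA unitization_bilinear unitization_norm.

Lemma unitization_mul1 (x : Aplus) : bmul unitization_one x = x.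
Proof.
by case: x => a c; congr (_, _); rewrite /= ?bmul0l ?scaler0 ?scale1r ?addr0 ?add0r ?mul1r.
Qed.

Lemma unitization_mulr1 (x : Aplus) : bmul x unitization_one = x.
Proof.
by case: x => a c; congr (_, _); rewrite /= ?bmul0r ?scaler0 ?scale1r ?add0r ?mulr1.
Qed.

End Unitization.

Section TensorBimodule.
Context {R : realType}.
Variable B : banachAlgType R[i].
Local Notation BB := (ptensor B B).

Lemma bmul_rnorm (a b : B) : rnorm (bmul a b) <= rnorm a * rnorm b.
Proof. by rewrite -lecR rmorphM /= -!rnormE; exact: bmul_norm. Qed.

Let bmul_bounded : exists2 M : R, 0 <= M &
  forall a b : B, rnorm (bmul a b) <= M * (rnorm a * rnorm b).
Proof. by exists 1 => // a b; rewrite mul1r bmul_rnorm. Qed.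

Definition ptensor_prod : blin BB B :=
  ptlift (BBilin bmul_bilinear bmul_bounded).

Lemma ptensor_prodE a b : ptensor_prod (ptens a b) = bmul a b.
Proof. exact: ptliftE. Qed.

Let lmul_bilinear (a : B) : bilinear_map (fun b c : B => ptens (bmul a b) c).
Proof.
have [tl tr] := ptens_bilinear B B; split=> [c k b b'|b k c c'].
  by have := bmul_bilinear.2 a k b b' => /= ->; exact: tl.
exact: tr.
Qed.

Let lmul_bound (a b c : B) :
  rnorm (ptens (bmul a b) c) <= rnorm a * (rnorm b * rnorm c).
Proof.
by rewrite (le_trans (ptens_norm _ _))// mulrA ler_wpM2r ?rnorm_ge0// bmul_rnorm.
Qed.

Let rmul_bilinear (a : B) : bilinear_map (fun b c : B => ptens b (bmul c a)).
Proof.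
have [tl tr] := ptens_bilinear B B; split=> [c k b b'|b k c c'].
  exact: tl.
by have := bmul_bilinear.1 a k c c' => /= ->; exact: tr.
Qed.

Let rmul_bound (a b c : B) :
  rnorm (ptens b (bmul c a)) <= rnorm a * (rnorm b * rnorm c).
Proof.
rewrite (le_trans (ptens_norm _ _))// mulrCA ler_wpM2l ?rnorm_ge0//.
by rewrite mulrC bmul_rnorm.
Qed.

Definition ptensor_lact (a : B) (t : BB) : BB :=
  ptlift (BBilin (lmul_bilinear a)
    (ex_intro2 _ _ (rnorm a) (rnorm_ge0 a) (lmul_bound a))) t.

Definition ptensor_ract (t : BB) (a : B) : BB :=
  ptlift (BBilin (rmul_bilinear a)
    (ex_intro2 _ _ (rnorm a) (rnorm_ge0 a) (rmul_bound a))) t.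

Lemma ptensor_lactE a b c : ptensor_lact a (ptens b c) = ptens (bmul a b) c.
Proof. exact: ptliftE. Qed.

Lemma ptensor_ractE b c a : ptensor_ract (ptens b c) a = ptens b (bmul c a).
Proof. exact: ptliftE. Qed.

Let lop (a : B) : blin BB BB := ptlift (BBilin (lmul_bilinear a)
    (ex_intro2 _ _ (rnorm a) (rnorm_ge0 a) (lmul_bound a))).
Let rop (a : B) : blin BB BB := ptlift (BBilin (rmul_bilinear a)
    (ex_intro2 _ _ (rnorm a) (rnorm_ge0 a) (rmul_bound a))).
Let lopE a b c : lop a (ptens b c) = ptens (bmul a b) c.
Proof. exact: ptliftE. Qed.
Let ropE a b c : rop a (ptens b c) = ptens b (bmul c a).
Proof. exact: ptliftE. Qed.

Let comp_is_blin (f g : blin BB BB) : f \o g \in @is_blin R BB BB.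
Proof.
apply/asboolP; split => [c x y|x] /=; first by rewrite !linearP.
by apply: continuous_comp; exact: blin_continuous.
Qed.
Let comp (f g : blin BB BB) : blin BB BB := Blin (comp_is_blin f g).
Let compE f g t : comp f g t = f (g t). Proof. by []. Qed.

Let ptensor_lact_bilinear : bilinear_map ptensor_lact.
Proof.
split=> [t k a b|a]; last exact: blin_linear.
suff : lop (k *: a + b) = k *: lop a + lop b by move=> /(congr1 (fun f : blin BB BB => f t)).
apply: ptensor_ext => x y; rewrite blinDE blinZE !lopE bmulDl bmulZl.
exact: (ptens_bilinear B B).1.
Qed.

Let ptensor_ract_bilinear : bilinear_map ptensor_ract.
Proof.
split=> [a|t k a b]; first exact: (blin_linear (rop a)).
suff : rop (k *: a + b) = k *: rop a + rop b by move=> /(congr1 (fun f : blin BB BB => f t)).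
apply: ptensor_ext => x y; rewrite blinDE blinZE !ropE bmulDr bmulZr.
exact: (ptens_bilinear B B).2.
Qed.

Let ptensor_lactM a b t : ptensor_lact (bmul a b) t = ptensor_lact a (ptensor_lact b t).
Proof.
suff : lop (bmul a b) = comp (lop a) (lop b) by move=> /(congr1 (fun f : blin BB BB => f t)).
by apply: ptensor_ext => x y; rewrite lopE !compE !lopE bmulA.
Qed.

Let ptensor_ractM t a b : ptensor_ract t (bmul a b) = ptensor_ract (ptensor_ract t a) b.
Proof.
suff : rop (bmul a b) = comp (rop b) (rop a) by move=> /(congr1 (fun f : blin BB BB => f t)).
by apply: ptensor_ext => x y; rewrite ropE !compE !ropE bmulA.
Qed.

Let ptensor_lact_ract a t b :
  ptensor_ract (ptensor_lact a t) b = ptensor_lact a (ptensor_ract t b).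
Proof.
suff : comp (rop b) (lop a) = comp (lop a) (rop b).
  by move=> /(congr1 (fun f : blin BB BB => f t)).
by apply: ptensor_ext => x y; rewrite !compE lopE !ropE lopE.
Qed.

Let ptensor_lact_bounded : exists2 M : R[i], 0 <= M &
  forall a t, `|ptensor_lact a t| <= M * (`|a| * `|t|).
Proof.
exists 1 => // a t; rewrite mul1r !rnormE -rmorphM lecR.
rewrite (le_trans (opnormP (lop a) t))// ler_wpM2r ?rnorm_ge0//.
by apply: ptlift_opnorm; [exact: rnorm_ge0|exact: lmul_bound].
Qed.

Let ptensor_ract_bounded : exists2 M : R[i], 0 <= M &
  forall t a, `|ptensor_ract t a| <= M * (`|t| * `|a|).
Proof.
exists 1 => // t a; rewrite mul1r !rnormE -rmorphM lecR mulrC.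
rewrite (le_trans (opnormP (rop a) t))// ler_wpM2r ?rnorm_ge0//.
by apply: ptlift_opnorm; [exact: rnorm_ge0|exact: rmul_bound].
Qed.

HB.instance Definition _ := isBanachBimodule.Build R[i] B (ptensor B B)
  ptensor_lact_bilinear ptensor_ract_bilinear ptensor_lactM ptensor_ractM
  ptensor_lact_ract ptensor_lact_bounded ptensor_ract_bounded.

End TensorBimodule.

Definition directed_preorder (I : Type) (le : I -> I -> Prop) : Prop :=
  [/\ inhabited I, (forall i, le i i),
      (forall i j k, le i j -> le j k -> le i k) &
      (forall i j, exists k, le i k /\ le j k)].

(* The sets containing a tail of [(I, le)]: a net indexed by [I] converges when it
   converges along this filter. *)
Definition net_filter (I : Type) (le : I -> I -> Prop) : set_system I :=
  [set P | exists i0, forall i, le i0 i -> P i].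

Lemma net_filter_proper (I : Type) (le : I -> I -> Prop) :
  directed_preorder le -> ProperFilter (net_filter le).
Proof.
move=> [[i0] lexx letr ledir]; apply: Build_ProperFilter_ex.
  by move=> P [i Pi]; exists i; exact: Pi.
split; first by exists i0.
- move=> P Q [i Pi] [j Qj]; have [k [ik jk]] := ledir i j.
  by exists k => l kl; split; [apply: Pi|apply: Qj]; exact: letr kl.
- by move=> P Q PQ [i Pi]; exists i => j ij; exact/PQ/Pi.
Qed.

(* Main.v *)
From HB Require Import structures.
Require Import Defs.
From mathcomp Require Import all_boot all_order all_algebra.
From mathcomp Require Import boolp classical_sets functions reals topology.
From mathcomp Require Import normedtype.
From mathcomp Require Import complex.
From mathcomp Require Import ring lra.

Import Order.TTheory GRing.Theory Num.Theory.
Import numFieldNormedType.Exports.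

Local Open Scope classical_set_scope.
Local Open Scope complex_scope.
Local Open Scope ring_scope.

(** Write [A_+] for the unitization of [A] and [pi] for the product map from
    [A_+ ⊗ A_+] to [A_+].

    Suppose that [A] is amenable. The map [a |-> 1 ⊗ a - a ⊗ 1] is a derivation
    of [A] into the kernel of [pi], hence into the bidual of this kernel, which
    is the dual of a Banach bimodule. It is therefore inner, say
    [a |-> a . N - N . a], and [M = 1 ⊗ 1 + N] satisfies [pi^** M = 1] and
    [a . M = M . a] exactly ([virtual_diagonal]); the constant net at [M] has
    the required properties. The kernel is described here by the isomorphism
    [x ⊗ b |-> x ⊗ b - x b ⊗ 1] from [A_+ ⊗ A], which turns its right action
    into the twisted action [(x ⊗ b) . a = x ⊗ b a - x b ⊗ a].

    Conversely, the net may be unbounded, so it need not have a weak-star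
    cluster point; but one of its members is enough, provided that its defects
    [1 - pi^** M] and [a . M - M . a] are small. Let [D : A -> X^*] be a
    continuous derivation, let [S] be the operator [a ⊗ b |-> a . D b] from
    [A_+ ⊗ A_+] to [X^*], extended to the bidual, and put [phi = S M]. The
    derivation rule gives [S (t . c) = S t . c + pi t . D c], whence
    [D c - (c . phi - phi . c) = (1 - pi^** M) . D c - S (c . M - M . c)]
    ([average_defect]). The right-hand side is at most a constant depending
    on [X] only, times the defects, times the norms of [D] and [c]. Here the
    convergence has to be uniform on bounded sets, so that one [M] serves all
    [c] in the unit ball and all [D]. Small defects thus yield an inner
    derivation at distance at most half the norm of [D] from [D], implemented
    by a [phi] of norm at most a multiple of that of [D]. Applying this again
    to the difference, and so on, writes [D] as a norm-convergent series of
    inner derivations whose implementing elements are summable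
    ([approx_surjective]); hence [D] is inner. *)

(** * Approximate preimages *)

Section ApproximateSurjectivity.
Context {R : realType}.

Lemma rnorm_geometric_sum {V : normedModType R[i]} (u : nat -> V) (C : R) :
  (forall n, rnorm (u n) <= C * 2^-1 ^+ n) ->
  forall m k, rnorm (\sum_(m <= j < m + k) u j) <= C * 2^-1 ^+ m * 2.
Proof.
move=> uC m k.
have C0 : 0 <= C.
  by have := uC 0%N; rewrite expr0 mulr1; apply: le_trans; exact: rnorm_ge0.
have h n : 0 <= 2^-1 ^+ n :> R by rewrite exprn_ge0// invr_ge0.
have Ch : 0 <= C * 2^-1 ^+ m * 2^-1 ^+ k by rewrite !mulr_ge0.
suff : rnorm (\sum_(m <= j < m + k) u j) <= C * 2^-1 ^+ m * (2 - 2 * 2^-1 ^+ k).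
  by lra.
elim: k {Ch} => [|k IH].
  by rewrite addn0 big_geq// rnorm0 expr0 mulr1 subrr mulr0.
rewrite addnS big_nat_recr ?leq_addr//= (le_trans (rnormD _ _))//.
rewrite (le_trans (lerD IH (uC _)))// exprD exprS le_eqVlt; apply/orP; left.
by apply/eqP; field.
Qed.

Lemma geometric_small (C e : R) : 0 <= C -> 0 < e ->
  exists N, forall n, (N <= n)%N -> C * 2^-1 ^+ n < e.
Proof.
move=> C0 e0; have [N hN] := invS_lt (divr_gt0 e0 (ltr_wpDl C0 ltr01)).
exists N => n Nn; have := hN n Nn.
rewrite ltr_pdivlMr ?ltr_wpDl// => /(le_lt_trans _)-> //.
have h : 2^-1 ^+ n <= n.+1%:R^-1 :> R.
  rewrite exprVn lef_pV2 ?posrE ?exprn_gt0// -natrX ler_nat.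
  exact: ltn_expl.
have h0 : 0 <= n.+1%:R^-1 :> R by rewrite invr_ge0.
by rewrite mulrDr mulr1 mulrC (le_trans (ler_wpM2r C0 h))// lerDl.
Qed.

Lemma seq_lim_blin {E F : normedModType R[i]} (L : blin E F) u l :
  seq_lim u l -> seq_lim (fun n => L (u n)) (L l).
Proof.
move=> /seq_limP ul; apply/seq_limP.
exact: cvg_comp ul (@blin_continuous _ _ _ L l).
Qed.

(** Correcting [z] by an approximate preimage halves it and stays in [Z], so
    the successive corrections decrease geometrically; their sum converges and
    is an exact preimage. This is the series of the open mapping theorem,
    run inside a subset. *)
Lemma approx_surjective {E : completeNormedModType R[i]}
    {F : normedModType R[i]} (L : blin E F) (Z : F -> Prop) (K : R) :
  (forall z, Z z -> exists x,
     [/\ rnorm x <= K * rnorm z, Z (z - L x) &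
         rnorm (z - L x) <= 2^-1 * rnorm z]) ->
  forall z, Z z -> exists x, z = L x.
Proof.
move=> approx z0 Zz0.
have /choice[g gP] : forall z, exists x, Z z ->
    [/\ rnorm x <= K * rnorm z, Z (z - L x) &
        rnorm (z - L x) <= 2^-1 * rnorm z].
  move=> z; have [/approx[x xP]|nZ] := pselect (Z z); first by exists x.
  by exists 0.
pose z n := iter n (fun y => y - L (g y)) z0.
have zS n : z n.+1 = z n - L (g (z n)) by [].
have Zz n : Z (z n) by elim: n => [|n /gP[]].
have zC n : rnorm (z n) <= rnorm z0 * 2^-1 ^+ n.
  elim: n => [|n IH]; first by rewrite expr0 mulr1.
  have [_ _ zz] := gP _ (Zz n); rewrite zS (le_trans zz)//.
  by rewrite exprS mulrCA ler_wpM2l ?invr_ge0.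
pose K' := Num.max K 0; have K'0 : 0 <= K' by rewrite le_max lexx orbT.
pose s n := \sum_(0 <= j < n) g (z j).
have sS n : s n.+1 = s n + g (z n) by rewrite /s big_nat_recr.
have sz n : z0 = z n + L (s n).
  elim: n => [|n IH]; first by rewrite /s big_geq// raddf0 addr0.
  by rewrite {1}IH zS sS raddfD addrCA subrK addrC.
have gC n : rnorm (g (z n)) <= K' * rnorm z0 * 2^-1 ^+ n.
  have [gK _ _] := gP _ (Zz n); rewrite (le_trans gK)//.
  rewrite (@le_trans _ _ (K' * rnorm (z n)))//.
    by rewrite ler_wpM2r ?rnorm_ge0// le_max lexx.
  by rewrite -mulrA ler_wpM2l.
have KC : 0 <= K' * rnorm z0 * 2 by rewrite !mulr_ge0 ?rnorm_ge0.
have sdist m k : rnorm (s (m + k)%N - s m) <= K' * rnorm z0 * 2^-1 ^+ m * 2.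
  rewrite /s (@big_cat_nat _ _ _ m)//= ?leq_addr// addrAC subrr add0r.
  exact: rnorm_geometric_sum.
have [e e0|x sx] := @complete_seq R E s.
  have [N hN] := geometric_small _ _ KC e0.
  exists N => m n; wlog mn : m n / (m <= n)%N.
    have [mn|/ltnW nm] := leqP m n; first exact.
    by move=> H Nm Nn; rewrite rdistC; exact: H.
  move=> Nm _; rewrite rdistC -(subnKC mn) (le_lt_trans (sdist _ _))//.
  by rewrite mulrAC; exact: hN.
exists x; apply: (@seq_lim_unique R F (fun=> z0)).
  by move=> e e0; exists 0%N => n _; rewrite subrr rnorm0.
move=> e e0; have e2 : 0 < e / 2 by rewrite divr_gt0.
have [N hN] := geometric_small _ _ (rnorm_ge0 z0) e2.
have [N' hN'] := seq_lim_blin L s x sx _ e2.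
exists (maxn N N') => n; rewrite geq_max => /andP[Nn N'n].
rewrite {1}(sz n) -addrA (le_lt_trans (rnormD _ _))// (splitr e) ltrD//.
  by rewrite (le_lt_trans (zC n))//; exact: hN.
exact: hN'.
Qed.

End ApproximateSurjectivity.

(** * Bilinear maps *)

Section BilinearMaps.
Context {K : fieldType} {E F W : lmodType K} {f : E -> F -> W}.
Hypothesis fb : bilinear_map f.

Lemma bilinDl x x' y : f (x + x') y = f x y + f x' y.
Proof. by have := fb.1 y 1 x x'; rewrite /= !scale1r. Qed.

Lemma bilinDr x y y' : f x (y + y') = f x y + f x y'.
Proof. by have := fb.2 x 1 y y'; rewrite /= !scale1r. Qed.

Lemma bilin0l y : f 0 y = 0.
Proof. by apply: (addrI (f 0 y)); rewrite -bilinDl !addr0. Qed.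

Lemma bilin0r x : f x 0 = 0.
Proof. by apply: (addrI (f x 0)); rewrite -bilinDr !addr0. Qed.

Lemma bilinZl k x y : f (k *: x) y = k *: f x y.
Proof. by have := fb.1 y k x 0; rewrite /= bilin0l !addr0. Qed.

Lemma bilinZr k x y : f x (k *: y) = k *: f x y.
Proof. by have := fb.2 x k y 0; rewrite /= bilin0r !addr0. Qed.

End BilinearMaps.

(** * Bounded operators *)

Lemma comp_is_blin {R : realType} {E F G : normedModType R[i]}
    (f : F -> G) (g : E -> F) :
  f \in @is_blin R F G -> g \in @is_blin R E F -> f \o g \in @is_blin R E G.
Proof.
move=> /asboolP[fl fc] /asboolP[gl gc]; apply/asboolP; split=> [c x y|x] /=.
  by rewrite gl fl.
by apply: continuous_comp; [exact: gc|exact: fc].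
Qed.

Lemma blin_sub {R : realType} {E F : normedModType R[i]} (f : blin E F) x y :
  f (x - y) = f x - f y.
Proof. exact: raddfB. Qed.

Lemma opnorm_ball_le {R : realType} {E F : normedModType R[i]}
    (f : blin E F) (e : R) :
  (forall x, rnorm x <= 1 -> rnorm (f x) <= e) -> opnorm f <= e.
Proof.
move=> fe; apply: ge_sup => [|_ [x x1 <-]]; last exact: fe.
by exists (rnorm (f 0)), 0 => //=; rewrite rnorm0.
Qed.

Lemma add_is_blin {R : realType} {E F : normedModType R[i]} (f g : E -> F) :
  f \in @is_blin R E F -> g \in @is_blin R E F ->
  (fun x => f x + g x) \in @is_blin R E F.
Proof. by move=> fb gb; exact: (blinP (Blin fb + Blin gb)). Qed.

(** * Completed tensor products *)

Lemma ptensor_eq {R : realType} {E F : normedModType R[i]}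
    {G : completeNormedModType R[i]} (f g : ptensor E F -> G) :
  f \in @is_blin R (ptensor E F) G -> g \in @is_blin R (ptensor E F) G ->
  (forall x y, f (ptens x y) = g (ptens x y)) -> forall t, f t = g t.
Proof.
move=> fb gb fg t.
have : Blin fb = Blin gb by apply: ptensor_ext.
by move=> /(congr1 (fun h : blin (ptensor E F) G => h t)).
Qed.

(** The completed tensor product, named so that its vectors always carry the
    normed structure underlying the complete one. *)
Definition tspace {R : realType} (E F : normedModType R[i]) :
  completeNormedModType R[i] := ptensor E F.

Section TensorSpace.
Context {R : realType} {E F : normedModType R[i]}.

Definition tpure (x : E) (y : F) : tspace E F := ptens x y.

Lemma tpure_bilinear : bilinear_map tpure.
Proof. exact: ptens_bilinear. Qed.

Lemma tpure_norm x y : rnorm (tpure x y) <= rnorm x * rnorm y.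
Proof. exact: ptens_norm. Qed.

Context {G : completeNormedModType R[i]}.

Definition tspace_lift (f : bbilin E F G) : blin (tspace E F) G := ptlift f.

Lemma tspace_liftE f x y : tspace_lift f (tpure x y) = f x y.
Proof. exact: ptliftE. Qed.

Lemma tspace_lift_opnorm (f : bbilin E F G) (M : R) : 0 <= M ->
  (forall x y, rnorm (f x y) <= M * (rnorm x * rnorm y)) ->
  opnorm (tspace_lift f) <= M.
Proof. exact: ptlift_opnorm. Qed.

Lemma tspace_eq (f g : tspace E F -> G) :
  f \in @is_blin R (tspace E F) G -> g \in @is_blin R (tspace E F) G ->
  (forall x y, f (tpure x y) = g (tpure x y)) -> forall t, f t = g t.
Proof. exact: ptensor_eq. Qed.

End TensorSpace.

(** Likewise for the bimodule [B ⊗ B]: the normed structure of its vectors, and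
    so that of its bidual, is always the one underlying the bimodule. *)
Definition tensor_square {R : realType} (B : banachAlgType R[i]) :
  banachBimodType B := ptensor B B.

Section TensorSquare.
Context {R : realType} {B : banachAlgType R[i]}.

Definition sqtens (x y : B) : tensor_square B := ptens x y.

Definition sqprod : blin (tensor_square B) B := ptensor_prod B.

Lemma sqtens_bilinear : bilinear_map sqtens.
Proof. exact: ptens_bilinear. Qed.

Lemma sqtens_norm x y : rnorm (sqtens x y) <= rnorm x * rnorm y.
Proof. exact: ptens_norm. Qed.

Lemma sqprodE x y : sqprod (sqtens x y) = bmul x y.
Proof. exact: ptensor_prodE. Qed.

Lemma lact_sqtens a x y : lact a (sqtens x y) = sqtens (bmul a x) y.
Proof. exact: ptensor_lactE. Qed.

Lemma ract_sqtens a x y : ract (sqtens x y) a = sqtens x (bmul y a).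
Proof. exact: ptensor_ractE. Qed.

Lemma tensor_square_eq {G : completeNormedModType R[i]}
    (f g : tensor_square B -> G) :
  f \in @is_blin R (tensor_square B) G ->
  g \in @is_blin R (tensor_square B) G ->
  (forall x y, f (sqtens x y) = g (sqtens x y)) -> forall t, f t = g t.
Proof. exact: ptensor_eq. Qed.

End TensorSquare.

(** * Extension of operators to the bidual *)

Lemma bidual_embedD {R : realType} {E : normedModType R[i]} (x y : E) :
  bidual_embed (x + y) = bidual_embed x + bidual_embed y.
Proof. by apply: blin_ext => f; rewrite bidual_embedE raddfD. Qed.

Section Flip.
Context {R : realType} {E X : normedModType R[i]}.
Variable S : blin E (dual_space X).

Let flip_eval_linear (x : X) : linear (fun t => S t x).
Proof. by move=> c t u; rewrite linearP. Qed.

Let flip_eval_bound (x : X) t : rnorm (S t x) <= opnorm S * rnorm x * rnorm t.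
Proof.
rewrite (le_trans (opnormP (S t) x))// mulrAC ler_wpM2r ?rnorm_ge0//.
exact: (opnormP S t).
Qed.

Let flip_fun (x : X) : dual_space E :=
  mk_blin (flip_eval_linear x) (flip_eval_bound x).

Let flip_linear : linear flip_fun.
Proof. by move=> c x y; apply: blin_ext => t /=; rewrite linearP. Qed.

Let flip_bound x : rnorm (flip_fun x) <= opnorm S * rnorm x.
Proof.
apply: opnorm_le; first by rewrite mulr_ge0 ?opnorm_ge0 ?rnorm_ge0.
exact: flip_eval_bound.
Qed.

Definition flip : blin X (dual_space E) := mk_blin flip_linear flip_bound.

Lemma flipE x t : flip x t = S t x. Proof. by []. Qed.

(** The weak-star continuous extension of [S] to the bidual: the bitranspose of
    [S] followed by the restriction of functionals from [X^**] to [X]. *)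
Definition bidual_ext : blin (bidual E) (dual_space X) := transpose flip.

Lemma bidual_extE M x : bidual_ext M x = M (flip x). Proof. by []. Qed.

Lemma bidual_ext_embed t : bidual_ext (bidual_embed t) = S t.
Proof. exact: blin_ext. Qed.

Lemma bidual_ext_bound M : rnorm (bidual_ext M) <= opnorm S * rnorm M.
Proof.
apply: opnorm_le; first by rewrite mulr_ge0 ?opnorm_ge0 ?rnorm_ge0.
move=> x; rewrite bidual_extE (le_trans (opnormP M _))// [leRHS]mulrAC mulrC.
by rewrite ler_wpM2r ?opnorm_ge0//; exact: flip_bound.
Qed.

End Flip.

(** * Bimodules and derivations *)

Section TransposeEquivariant.
Context {R : realType} {A B : banachAlgType R[i]}.
Context {X : banachBimodType A} {Y : banachBimodType B}.
Variables (T : blin X Y) (a : A) (b : B).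

Lemma transpose_lact : (forall x, T (ract x a) = ract (T x) b) ->
  forall f : dual_space Y, transpose T (lact b f) = lact a (transpose T f).
Proof.
by move=> Ta f; apply: blin_ext => x; exact: (congr1 f (esym (Ta x))).
Qed.

Lemma transpose_ract : (forall x, T (lact a x) = lact b (T x)) ->
  forall f : dual_space Y, transpose T (ract f b) = ract (transpose T f) a.
Proof.
by move=> Ta f; apply: blin_ext => x; exact: (congr1 f (esym (Ta x))).
Qed.

End TransposeEquivariant.

Section BidualEmbedEquivariant.
Context {R : realType} {A : banachAlgType R[i]} {X : banachBimodType A}.

Lemma lact_bidual_embed (a : A) (x : X) :
  lact a (bidual_embed x) = bidual_embed (lact a x).
Proof. exact: blin_ext. Qed.

Lemma ract_bidual_embed (x : X) (a : A) :
  ract (bidual_embed x) a = bidual_embed (ract x a).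
Proof. exact: blin_ext. Qed.

End BidualEmbedEquivariant.

Section Derivations.
Context {R : realType} {A : banachAlgType R[i]} {Y : banachBimodType A}.
Implicit Types (a b : A) (y : Y).

Lemma lactD a x y : lact a (x + y) = lact a x + lact a y.
Proof. exact: (bilinDr lact_bilinear). Qed.

Lemma lactZ a (c : R[i]) y : lact a (c *: y) = c *: lact a y.
Proof. exact: (bilinZr lact_bilinear). Qed.

Lemma lactB a x y : lact a (x - y) = lact a x - lact a y.
Proof. exact: (raddfB (lact_blin Y a)). Qed.

Lemma lactDl a b y : lact (a + b) y = lact a y + lact b y.
Proof. exact: (bilinDl lact_bilinear). Qed.

Lemma lact0l y : lact (0 : A) y = 0.
Proof. exact: (bilin0l lact_bilinear). Qed.

Lemma lactZl (c : R[i]) a y : lact (c *: a) y = c *: lact a y.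
Proof. exact: (bilinZl lact_bilinear). Qed.

Lemma ractDl x y a : ract (x + y) a = ract x a + ract y a.
Proof. exact: (bilinDl ract_bilinear). Qed.

Lemma ractZl (c : R[i]) y a : ract (c *: y) a = c *: ract y a.
Proof. exact: (bilinZl ract_bilinear). Qed.

Lemma ractB x y a : ract (x - y) a = ract x a - ract y a.
Proof. exact: (raddfB (ract_blin Y a)). Qed.

Lemma ractDr y a b : ract y (a + b) = ract y a + ract y b.
Proof. exact: (bilinDr ract_bilinear). Qed.

Lemma ractZr (c : R[i]) y a : ract y (c *: a) = c *: ract y a.
Proof. exact: (bilinZr ract_bilinear). Qed.

Definition derivation (D : A -> Y) :=
  forall a b, D (bmul a b) = lact a (D b) + ract (D a) b.

Let inner_fun_linear y : linear (fun a : A => lact a y - ract y a).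
Proof.
move=> c a b; rewrite lactDl lactZl ractDr ractZr.
by rewrite opprD addrACA -scalerBr.
Qed.

Let inner_bound : exists2 K : R, 0 <= K & forall y a,
  rnorm (lact a y - ract y a) <= K * rnorm y * rnorm a.
Proof.
have [K K0 hK] := lact_rnorm Y; have [L L0 hL] := ract_rnorm Y.
exists (K + L) => [|y a]; first by rewrite addr_ge0.
rewrite (le_trans (rnormD _ _))// rnormN mulrDl mulrDl lerD//.
  by rewrite -mulrA [rnorm y * _]mulrC.
by rewrite -mulrA.
Qed.

Let inner_fun_bound y : exists K : R, forall a,
  rnorm (lact a y - ract y a) <= K * rnorm a.
Proof. by have [K _ hK] := inner_bound; exists (K * rnorm y). Qed.

Let inner_fun y : blin A Y :=
  mk_blin (inner_fun_linear y) (projT2 (cid (inner_fun_bound y))).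

Let inner_linear : linear inner_fun.
Proof.
move=> c x y; apply: blin_ext => a /=.
rewrite lactD lactZ ractDl ractZl.
by rewrite opprD addrACA -scalerBr.
Qed.

Let inner_opnorm : exists K : R, forall y, rnorm (inner_fun y) <= K * rnorm y.
Proof.
have [K K0 hK] := inner_bound; exists K => y.
by apply: opnorm_le => [|a]; [rewrite mulr_ge0 ?rnorm_ge0|exact: hK].
Qed.

Definition inner : blin Y (blin A Y) :=
  mk_blin inner_linear (projT2 (cid inner_opnorm)).

Lemma innerE y a : inner y a = lact a y - ract y a. Proof. by []. Qed.

Lemma inner_derivation y : derivation (inner y).
Proof.
move=> a b; rewrite !innerE lactM ractM lactB ractB lact_ract.
by rewrite addrA subrK.
Qed.

Lemma derivationB (D D' : blin A Y) :
  derivation D -> derivation D' -> derivation (D - D').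
Proof.
move=> hD hD' a b; rewrite !blinBE hD hD' lactB ractB.
by rewrite opprD addrACA.
Qed.

End Derivations.

(** * The unitization and its action *)

Section Unitization.
Context {R : realType} {A : banachAlgType R[i]}.
Local Notation Aplus := (unitization A).

Definition uincl (a : A) : Aplus := (a, 0).

Lemma uincl_linear : linear uincl.
Proof. by move=> c a b; congr (_, _); rewrite /= scaler0 addr0. Qed.

Lemma uinclM a b : uincl (bmul a b) = bmul (uincl a) (uincl b).
Proof. by congr (_, _); rewrite /= ?scale0r ?addr0 ?mul0r. Qed.

Lemma rnorm_uincl a : rnorm (uincl a) = rnorm a.
Proof. by rewrite unitization_rnorm/= rnorm0 addr0. Qed.

Lemma rnorm_unitization_one : rnorm (unitization_one A) = 1.
Proof. by rewrite unitization_rnorm /= rnorm0 add0r /rnorm normr1. Qed.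

Lemma unitizationE (x : Aplus) : x = x.2 *: unitization_one A + uincl x.1.
Proof.
case: x => a c; congr (_, _) => /=; first by rewrite scaler0 add0r.
by rewrite addr0 -[_ *: _]/(_ * _) mulr1.
Qed.

Context {Y : banachBimodType A}.

(** The left action of [A], extended so that the identity of [A_+] acts as the
    identity. *)
Definition uact (x : Aplus) (y : Y) : Y := lact x.1 y + x.2 *: y.

Lemma uact_bilinear : bilinear_map uact.
Proof.
split=> [y c x x'|x c y y'].
  by rewrite /uact /= lactDl lactZl scalerDl -scalerA scalerDr addrACA.
by rewrite /uact lactD lactZ !scalerDr !scalerA [x.2 * c]mulrC addrACA.
Qed.

Lemma uactDr x y y' : uact x (y + y') = uact x y + uact x y'.
Proof. exact: (bilinDr uact_bilinear). Qed.

(** The constant serves all derivations into [Y] at once: it decides how small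
    the defects of an approximate diagonal have to be. *)
Lemma uact_bounded : exists2 K : R, 0 <= K &
  forall x y, rnorm (uact x y) <= K * (rnorm x * rnorm y).
Proof.
have [K K0 hK] := lact_rnorm Y; exists (K + 1) => [|x y].
  by rewrite addr_ge0.
have x1 : rnorm x.1 <= rnorm x by rewrite unitization_rnorm lerDl rnorm_ge0.
have x2 : rnorm x.2 <= rnorm x by rewrite unitization_rnorm lerDr rnorm_ge0.
rewrite (le_trans (rnormD _ _))// mulrDl mul1r lerD//.
  by rewrite (le_trans (hK _ _))// ler_wpM2l// ler_wpM2r// rnorm_ge0.
by rewrite rnormZ ler_wpM2r// rnorm_ge0.
Qed.

Lemma uact_uincl a y : uact (uincl a) y = lact a y.
Proof. by rewrite /uact /= scale0r addr0. Qed.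

Lemma uactM x x' y : uact (bmul x x') y = uact x (uact x' y).
Proof.
rewrite /uact /= !lactDl !lactZl lactM lactD lactZ scalerDr scalerA.
by rewrite -!addrA; congr (_ + _); rewrite addrCA.
Qed.

Lemma uact_ract x y a : uact x (ract y a) = ract (uact x y) a.
Proof. by rewrite /uact ractDl ractZl lact_ract. Qed.

Lemma uact1 y : uact (unitization_one A) y = y.
Proof. by rewrite /uact /= scale1r lact0l add0r. Qed.

Let uact_is_blin (y : Y) : (fun x => uact x y) \in @is_blin R Aplus Y.
Proof.
have [K _ hK] := uact_bounded.
apply: (@bounded_is_blin _ _ _ _ (K * rnorm y)).
  by move=> c x x'; exact: uact_bilinear.1.
by move=> x; rewrite -mulrA [rnorm y * _]mulrC.
Qed.

Definition uact_blin (y : Y) : blin Aplus Y := Blin (uact_is_blin y).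

Lemma uact_blinE y x : uact_blin y x = uact x y. Proof. by []. Qed.

End Unitization.

(** * Averaging a derivation over a tensor *)

Section Averaging.
Context {R : realType} {A : banachAlgType R[i]} {Y : banachBimodType A}.
Local Notation Aplus := (unitization A).
Local Notation AA := (tensor_square Aplus).
Variable D : blin A Y.

Let average_bilinear : bilinear_map (fun x y : Aplus => uact x (D y.1)).
Proof.
have [ul ur] := @uact_bilinear R A Y.
split=> [y c x x'|x c y y']; first exact: ul.
by rewrite linearP; exact: ur.
Qed.

Let average_bound (K : R) : 0 <= K ->
  (forall (x : Aplus) (y : Y), rnorm (uact x y) <= K * (rnorm x * rnorm y)) ->
  forall x y : Aplus,
    rnorm (uact x (D y.1)) <= K * opnorm D * (rnorm x * rnorm y).
Proof.
move=> K0 hK x y; rewrite (le_trans (hK _ _))// -mulrA ler_wpM2l// mulrCA.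
rewrite ler_wpM2l ?rnorm_ge0// (le_trans (opnormP _ _))//.
by rewrite ler_wpM2l ?opnorm_ge0// unitization_rnorm lerDl rnorm_ge0.
Qed.

Let average_bounded : exists2 M : R, 0 <= M & forall x y : Aplus,
  rnorm (uact x (D y.1)) <= M * (rnorm x * rnorm y).
Proof.
have [K K0 hK] := @uact_bounded R A Y; exists (K * opnorm D).
  by rewrite mulr_ge0 ?opnorm_ge0.
exact: average_bound.
Qed.

(** The operator [a ⊗ b |-> a . D b]. At a diagonal element it averages the
    elements [a . D b] into one that implements [D]: for the group algebra of a
    finite group, with diagonal the mean of the [g ⊗ g^-1], this is the usual
    average of [g . D (g^-1)] over the group. *)
Definition average : blin AA Y :=
  ptlift (BBilin average_bilinear average_bounded).

Lemma averageE x y : average (sqtens x y) = uact x (D y.1).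
Proof. exact: ptliftE. Qed.

Lemma average_opnorm (K : R) : 0 <= K ->
  (forall (x : Aplus) (y : Y), rnorm (uact x y) <= K * (rnorm x * rnorm y)) ->
  opnorm average <= K * opnorm D.
Proof.
move=> K0 hK; apply: ptlift_opnorm; first by rewrite mulr_ge0 ?opnorm_ge0.
exact: average_bound.
Qed.

Lemma average_lact c t : average (lact (uincl c) t) = lact c (average t).
Proof.
move: t; apply: tensor_square_eq => [||x y].
- exact: comp_is_blin (blinP average) (blinP (lact_blin AA _)).
- exact: comp_is_blin (blinP (lact_blin Y c)) (blinP average).
by rewrite lact_sqtens !averageE uactM uact_uincl.
Qed.

(** Averaging is a left module map; on the right the derivation rule
    [D (b c) = b . D c + D b . c] adds the term [pi t . D c], by which [D]
    itself reappears. *)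
Lemma average_ract (hD : derivation D) c t :
  average (ract t (uincl c)) = ract (average t) c + uact (sqprod t) (D c).
Proof.
move: t; apply: tensor_square_eq => [||x y].
- exact: comp_is_blin (blinP average) (blinP (ract_blin AA _)).
- apply: add_is_blin.
    exact: comp_is_blin (blinP (ract_blin Y c)) (blinP average).
  exact: comp_is_blin (blinP (uact_blin (D c))) (blinP sqprod).
rewrite ract_sqtens !averageE sqprodE uactM -uact_ract -uactDr.
congr uact; rewrite /= scale0r addr0 addrC blin_linear hD.
by rewrite /uact addrC addrAC addrC.
Qed.

End Averaging.

(** * From one approximate diagonal to amenability *)

Section ApproximateDiagonal.
Context {R : realType} {A : banachAlgType R[i]}.
Local Notation Aplus := (unitization A).
Local Notation AA := (tensor_square Aplus).

Section Defect.
Context {X : banachBimodType A}.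
Variables (D : blin A (dual_space X)) (M : bidual AA).

Lemma average_bidual_lact c :
  bidual_ext (average D) (lact (uincl c) M) =
  lact c (bidual_ext (average D) M).
Proof.
apply: transpose_lact => x; apply: blin_ext => t.
rewrite flipE -[RHS]/(average D (lact (uincl c) t) x).
by rewrite average_lact.
Qed.

Lemma average_bidual_ract (hD : derivation D) c :
  bidual_ext (average D) (ract M (uincl c)) =
  ract (bidual_ext (average D) M) c +
  bidual_ext (uact_blin (D c)) (bitranspose sqprod M).
Proof.
apply: blin_ext => x; rewrite blinDE.
rewrite -[LHS]/(M (dual_lact (uincl c) (flip (average D) x))).
rewrite -[RHS]/(M (flip (average D) (lact c x)) +
  M (transpose sqprod (flip (uact_blin (D c)) x))).
rewrite -raddfD; congr (M _); apply: blin_ext => t.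
rewrite -[LHS]/(average D (ract t (uincl c)) x).
by rewrite average_ract.
Qed.

(** For an exact diagonal both terms on the right vanish, and [D] is the inner
    derivation given by [bidual_ext (average D) M]. *)
Lemma average_defect (hD : derivation D) c :
  D c - inner (bidual_ext (average D) M) c =
  bidual_ext (uact_blin (D c))
    (bidual_embed (unitization_one A) - bitranspose sqprod M) -
  bidual_ext (average D) (inner M (uincl c)).
Proof.
rewrite [inner M _]innerE [bidual_ext (uact_blin _) _]blin_sub.
rewrite [bidual_ext (average D) (_ - _)]blin_sub.
rewrite bidual_ext_embed uact_blinE uact1 average_bidual_lact.
rewrite (average_bidual_ract hD) innerE.
rewrite !opprB -!addrA; congr (_ + _).
by rewrite [RHS]addrCA addKr.
Qed.

End Defect.

Definition approx_diagonal (e : R) (M : bidual AA) :=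
  rnorm (bidual_embed (unitization_one A) - bitranspose sqprod M) <= e /\
  opnorm (inner M) <= e.

(** Arbitrarily small defects are required because the threshold depends on the
    norm of the action on [X]. *)
Lemma amenable_approx_diagonal :
  (forall e : R, 0 < e -> exists M, approx_diagonal e M) -> amenable A.
Proof.
move=> diag X D Dl Dc hD.
have [K K0 hK] := @uact_bounded R A (dual_space X).
(* Each of the two terms of [average_defect] is to be at most a quarter of
   [opnorm z * rnorm c]. *)
have K4 : 0 < 4 * (K + 1) by rewrite mulr_gt0// ltr_wpDl.
have e0 : 0 < (4 * (K + 1))^-1 by rewrite invr_gt0.
have [M []] := diag _ e0; set e := (4 * (K + 1))^-1 in e0 *; move=> M1 Mc.
have Ke : K * e <= 4^-1.
  rewrite /e invfM mulrCA ger_pMr ?invr_gt0// ler_pdivrMr ?ltr_wpDl//.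
  by rewrite mul1r lerDl.
pose D' : blin A (dual_space X) := Blin (asboolT (conj Dl Dc)).
suff [x Dx] : exists x, D' = inner x.
  by exists x => a; rewrite -innerE -Dx.
have uactK (y : dual_space X) : opnorm (uact_blin y) <= K * rnorm y.
  apply: opnorm_le => [|x]; first by rewrite mulr_ge0 ?rnorm_ge0.
  rewrite -mulrA [rnorm y * _]mulrC; exact: hK.
apply: (@approx_surjective R _ _ inner (fun z => derivation z) (K * rnorm M));
  last exact: hD.
move=> z hz; exists (bidual_ext (average z) M).
have avgK := average_opnorm z K K0 hK; split.
- rewrite (le_trans (bidual_ext_bound _ _))// mulrAC.
  by rewrite ler_wpM2r ?rnorm_ge0.
- by apply: derivationB => //; exact: inner_derivation.
- apply: opnorm_le => [|c]; first by rewrite mulr_ge0 ?invr_ge0 ?opnorm_ge0.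
  rewrite blinBE average_defect// (le_trans (rnormD _ _))// rnormN.
  have h1 : rnorm (bidual_ext (uact_blin (z c))
      (bidual_embed (unitization_one A) - bitranspose sqprod M)) <=
      K * e * (opnorm z * rnorm c).
    rewrite (le_trans (bidual_ext_bound _ _))//.
    rewrite (le_trans (ler_wpM2r (rnorm_ge0 _) (uactK _)))//.
    rewrite mulrAC ler_pM ?mulr_ge0 ?rnorm_ge0//; first by rewrite ler_wpM2l.
    exact: opnormP.
  have Muc : rnorm (inner M (uincl c)) <= e * rnorm c.
    rewrite (le_trans (opnormP (inner M) _))// rnorm_uincl.
    by rewrite ler_wpM2r ?rnorm_ge0.
  have h2 : rnorm (bidual_ext (average z) (inner M (uincl c))) <=
      K * e * (opnorm z * rnorm c).
    rewrite (le_trans (bidual_ext_bound _ _))//.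
    rewrite (le_trans (ler_wpM2r (rnorm_ge0 _) avgK))//.
    by rewrite [leRHS]mulrACA ler_wpM2l ?mulr_ge0 ?opnorm_ge0.
  rewrite (le_trans (lerD h1 h2))// -mulrDl -mulrA.
  rewrite ler_wpM2r ?mulr_ge0 ?opnorm_ge0 ?rnorm_ge0//.
  lra.
Qed.

End ApproximateDiagonal.

(** * The kernel of the product and its inclusion *)

Section KernelModule.
Context {R : realType} {A : banachAlgType R[i]}.
Local Notation Aplus := (unitization A).
Local Notation KA := (tspace Aplus A).
Implicit Types (x y : Aplus) (a b c : A).

Let klact_fun (a : A) (x : Aplus) (b : A) : KA := tpure (bmul (uincl a) x) b.

Let kract_fun (a : A) (x : Aplus) (b : A) : KA :=
  tpure x (bmul b a) - tpure (bmul x (uincl b)) a.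

Let klact_bilinear a : bilinear_map (klact_fun a).
Proof.
split=> [b k x y|x k b c]; rewrite /klact_fun.
  by rewrite bmulDr bmulZr (bilinDl tpure_bilinear) (bilinZl tpure_bilinear).
by rewrite (bilinDr tpure_bilinear) (bilinZr tpure_bilinear).
Qed.

Let kract_bilinear a : bilinear_map (kract_fun a).
Proof.
split=> [b k x y|x k b c]; rewrite /kract_fun.
  rewrite bmulDl bmulZl !(bilinDl tpure_bilinear) !(bilinZl tpure_bilinear).
  by rewrite opprD addrACA scalerBr.
rewrite bmulDl bmulZl (bilinDr tpure_bilinear) (bilinZr tpure_bilinear).
rewrite uincl_linear bmulDr bmulZr (bilinDl tpure_bilinear).
by rewrite (bilinZl tpure_bilinear) opprD addrACA scalerBr.
Qed.

Let klact_bound a x b :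
  rnorm (klact_fun a x b) <= rnorm a * (rnorm x * rnorm b).
Proof.
rewrite (le_trans (tpure_norm _ _))// mulrA ler_wpM2r ?rnorm_ge0//.
by rewrite (le_trans (bmul_rnorm _ _))// rnorm_uincl.
Qed.

Let kract_bound a x b :
  rnorm (kract_fun a x b) <= 2 * rnorm a * (rnorm x * rnorm b).
Proof.
rewrite (le_trans (rnormD _ _))// rnormN -mulrA mulr2n mulrDl mul1r lerD//.
  rewrite (le_trans (tpure_norm _ _))// mulrCA ler_wpM2l ?rnorm_ge0//.
  by rewrite (le_trans (bmul_rnorm _ _))// mulrC.
rewrite (le_trans (tpure_norm _ _))// mulrC ler_wpM2l ?rnorm_ge0//.
by rewrite (le_trans (bmul_rnorm _ _))// rnorm_uincl.
Qed.

Let rnorm2_ge0 (a : A) : 0 <= 2 * rnorm a.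
Proof. by rewrite mulr_ge0 ?rnorm_ge0. Qed.

(* The actions are determined by their values on pure tensors; from here on only
   these values and the norm bounds matter. *)
Let klact_spec a : {f : blin KA KA |
  (forall x b, f (tpure x b) = tpure (bmul (uincl a) x) b) &
  opnorm f <= rnorm a}.
Proof.
exists (tspace_lift (BBilin (klact_bilinear a)
  (ex_intro2 _ _ (rnorm a) (rnorm_ge0 a) (klact_bound a)))) => [x b|].
  exact: tspace_liftE.
by apply: tspace_lift_opnorm; [exact: rnorm_ge0|exact: klact_bound].
Qed.

Let kract_spec a : {f : blin KA KA |
  (forall x b,
    f (tpure x b) = tpure x (bmul b a) - tpure (bmul x (uincl b)) a) &
  opnorm f <= 2 * rnorm a}.
Proof.
exists (tspace_lift (BBilin (kract_bilinear a)
  (ex_intro2 _ _ (2 * rnorm a) (rnorm2_ge0 a) (kract_bound a)))) => [x b|].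
  exact: tspace_liftE.
by apply: tspace_lift_opnorm; [exact: rnorm2_ge0|exact: kract_bound].
Qed.

Let klact_op a : blin KA KA := s2val (klact_spec a).
Let kract_op a : blin KA KA := s2val (kract_spec a).

Let klact_opE a x b : klact_op a (tpure x b) = tpure (bmul (uincl a) x) b.
Proof. exact: (s2valP (klact_spec a)). Qed.

Let kract_opE a x b :
  kract_op a (tpure x b) = tpure x (bmul b a) - tpure (bmul x (uincl b)) a.
Proof. exact: (s2valP (kract_spec a)). Qed.

Definition kernel_lact (a : A) (t : KA) : KA := klact_op a t.
Definition kernel_ract (t : KA) (a : A) : KA := kract_op a t.

Let kernel_lact_bilinear : bilinear_map kernel_lact.
Proof.
split=> [t k a b|a]; last exact: (blin_linear (klact_op a)).
suff : klact_op (k *: a + b) = k *: klact_op a + klact_op b.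
  by move=> /(congr1 (fun f : blin KA KA => f t)).
apply/blin_ext; apply: tspace_eq; [exact: blinP|exact: blinP|move=> x c].
rewrite blinDE blinZE !klact_opE.
rewrite uincl_linear bmulDl bmulZl.
by rewrite (bilinDl tpure_bilinear) (bilinZl tpure_bilinear).
Qed.

Let kernel_ract_bilinear : bilinear_map kernel_ract.
Proof.
split=> [a|t k a b]; first exact: (blin_linear (kract_op a)).
suff : kract_op (k *: a + b) = k *: kract_op a + kract_op b.
  by move=> /(congr1 (fun f : blin KA KA => f t)).
apply/blin_ext; apply: tspace_eq; [exact: blinP|exact: blinP|move=> x c].
rewrite blinDE blinZE !kract_opE.
rewrite bmulDr bmulZr !(bilinDr tpure_bilinear) !(bilinZr tpure_bilinear).
by rewrite opprD addrACA scalerBr.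
Qed.

Let kernel_lactM a b t :
  kernel_lact (bmul a b) t = kernel_lact a (kernel_lact b t).
Proof.
move: t; apply: tspace_eq; first exact: blinP.
  exact: comp_is_blin (blinP (klact_op a)) (blinP (klact_op b)).
by move=> x c; rewrite /kernel_lact !klact_opE uinclM bmulA.
Qed.

Let kernel_ractM t a b :
  kernel_ract t (bmul a b) = kernel_ract (kernel_ract t a) b.
Proof.
move: t; apply: tspace_eq; first exact: (blinP (kract_op _)).
  exact: comp_is_blin (blinP (kract_op b)) (blinP (kract_op a)).
move=> x c; rewrite /kernel_ract !kract_opE blin_sub !kract_opE.
by rewrite uinclM !bmulA opprB addrA subrK.
Qed.

Let kernel_lact_ract a t b :
  kernel_ract (kernel_lact a t) b = kernel_lact a (kernel_ract t b).
Proof.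
move: t; apply: tspace_eq.
- exact: comp_is_blin (blinP (kract_op b)) (blinP (klact_op a)).
- exact: comp_is_blin (blinP (klact_op a)) (blinP (kract_op b)).
move=> x c; rewrite /kernel_ract /kernel_lact klact_opE !kract_opE.
by rewrite blin_sub !klact_opE bmulA.
Qed.

Let kernel_lact_bounded : exists2 M : R[i], 0 <= M &
  forall a t, `|kernel_lact a t| <= M * (`|a| * `|t|).
Proof.
exists 1 => // a t; rewrite mul1r !rnormE -rmorphM lecR.
rewrite (le_trans (opnormP (klact_op a) t))// ler_wpM2r ?rnorm_ge0//.
exact: (s2valP' (klact_spec a)).
Qed.

Let kernel_ract_bounded : exists2 M : R[i], 0 <= M &
  forall t a, `|kernel_ract t a| <= M * (`|t| * `|a|).
Proof.
exists (2 : R)%:C => [|t a]; first by rewrite ler0c.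
rewrite !rnormE -!rmorphM lecR [rnorm t * _]mulrC mulrA.
rewrite (le_trans (opnormP (kract_op a) t))// ler_wpM2r ?rnorm_ge0//.
exact: (s2valP' (kract_spec a)).
Qed.

(** The kernel of [pi : A_+ ⊗ A_+ -> A_+] as an [A]-bimodule, transported to
    [A_+ ⊗ A] along [x ⊗ b |-> x ⊗ b - x b ⊗ 1]. Since
    [(x ⊗ b - x b ⊗ 1) . a = x ⊗ b a - x b ⊗ a] is the difference of the images
    of [x ⊗ b a] and [x b ⊗ a], the right action is the twisted one. *)
Definition kernel_module : banachBimodType A :=
  HB.pack KA (isBanachBimodule.Build R[i] A KA
    kernel_lact_bilinear kernel_ract_bilinear kernel_lactM kernel_ractM
    kernel_lact_ract kernel_lact_bounded kernel_ract_bounded).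

Definition kpure (x : Aplus) (b : A) : kernel_module := tpure x b.

Lemma kpure_bilinear : bilinear_map kpure.
Proof. exact: tpure_bilinear. Qed.

Lemma kpure_norm x b : rnorm (kpure x b) <= rnorm x * rnorm b.
Proof. exact: tpure_norm. Qed.

Lemma kernel_lift {B : banachAlgType R[i]} {G : banachBimodType B}
    (f : bbilin Aplus A G) :
  {T : blin kernel_module G | forall x b, T (kpure x b) = f x b}.
Proof. by exists (tspace_lift f) => x b; exact: tspace_liftE. Qed.

Lemma kernel_module_eq {G : completeNormedModType R[i]}
    (f g : kernel_module -> G) :
  f \in @is_blin R kernel_module G -> g \in @is_blin R kernel_module G ->
  (forall x b, f (kpure x b) = g (kpure x b)) -> forall t, f t = g t.
Proof. exact: tspace_eq. Qed.

Lemma lact_kpure (a : A) x b :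
  lact a (kpure x b) = kpure (bmul (uincl a) x) b.
Proof. exact: klact_opE. Qed.

Lemma ract_kpure (a : A) x b :
  ract (kpure x b) a = kpure x (bmul b a) - kpure (bmul x (uincl b)) a.
Proof. exact: kract_opE. Qed.

End KernelModule.

Section VirtualDiagonal.
Context {R : realType} {A : banachAlgType R[i]}.
Local Notation Aplus := (unitization A).
Local Notation AA := (tensor_square Aplus).
Local Notation KA := (@kernel_module R A).
Local Notation one := (unitization_one A).

Let kernel_incl_fun (x : Aplus) (b : A) : AA :=
  sqtens x (uincl b) - sqtens (bmul x (uincl b)) one.

Let kernel_incl_bilinear : bilinear_map kernel_incl_fun.
Proof.
have st := @sqtens_bilinear R Aplus.
split=> [b k x y|x k b c]; rewrite /kernel_incl_fun.
  rewrite bmulDl bmulZl !(bilinDl st) !(bilinZl st).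
  by rewrite opprD addrACA scalerBr.
rewrite uincl_linear bmulDr bmulZr (bilinDr st) (bilinZr st).
by rewrite (bilinDl st) (bilinZl st) opprD addrACA scalerBr.
Qed.

Let kernel_incl_bound x b :
  rnorm (kernel_incl_fun x b) <= 2 * (rnorm x * rnorm b).
Proof.
rewrite (le_trans (rnormD _ _))// rnormN mulr2n mulrDl mul1r lerD//.
  by rewrite (le_trans (sqtens_norm _ _))// rnorm_uincl.
rewrite (le_trans (sqtens_norm _ _))// rnorm_unitization_one mulr1.
by rewrite (le_trans (bmul_rnorm _ _))// rnorm_uincl.
Qed.

Let kernel_incl_spec :=
  @kernel_lift R A Aplus AA (@BBilin R Aplus A AA
    kernel_incl_fun kernel_incl_bilinear
    (ex_intro2 _ _ 2 (ler0n _ _) kernel_incl_bound)).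

Definition kernel_incl : blin KA AA := sval kernel_incl_spec.

Lemma kernel_inclE x b :
  kernel_incl (kpure x b) = sqtens x (uincl b) - sqtens (bmul x (uincl b)) one.
Proof. exact: (svalP kernel_incl_spec). Qed.

Lemma kernel_incl_lact a t :
  kernel_incl (lact a t) = lact (uincl a) (kernel_incl t).
Proof.
move: t; apply: kernel_module_eq => [||x b].
- exact: comp_is_blin (blinP kernel_incl) (blinP (lact_blin KA a)).
- exact: comp_is_blin (blinP (lact_blin AA _)) (blinP kernel_incl).
by rewrite lact_kpure !kernel_inclE lactB !lact_sqtens bmulA.
Qed.

Lemma kernel_incl_ract t a :
  kernel_incl (ract t a) = ract (kernel_incl t) (uincl a).
Proof.
move: t; apply: kernel_module_eq => [||x b].
- exact: comp_is_blin (blinP kernel_incl) (blinP (ract_blin KA a)).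
- exact: comp_is_blin (blinP (ract_blin AA _)) (blinP kernel_incl).
rewrite ract_kpure blin_sub !kernel_inclE ractB !ract_sqtens unitization_mul1.
by rewrite uinclM !bmulA opprB addrA subrK.
Qed.

Lemma sqprod_kernel_incl t : sqprod (kernel_incl t) = 0.
Proof.
move: t; apply: kernel_module_eq => [||x b].
- exact: comp_is_blin (blinP sqprod) (blinP kernel_incl).
- exact: (blinP (0 : blin KA Aplus)).
by rewrite kernel_inclE blin_sub !sqprodE unitization_mulr1 subrr.
Qed.

(* Under [kernel_incl], [kpure one a] becomes [1 ⊗ a - a ⊗ 1]. *)
Let der (a : A) : bidual KA := bidual_embed (kpure one a).

Let der_is_blin : der \in @is_blin R A (bidual KA).
Proof.
apply: (@bounded_is_blin _ _ _ _ 1) => [k a b|a].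
  apply: blin_ext => f; rewrite /der (kpure_bilinear.2 one k a b).
  exact: blin_linear.
have pure_a : rnorm (kpure one a) <= rnorm a.
  by rewrite (le_trans (kpure_norm _ _))// rnorm_unitization_one mul1r.
rewrite mul1r; apply: opnorm_le => [|f]; first exact: rnorm_ge0.
rewrite (le_trans (opnormP f _))// mulrC ler_wpM2r ?opnorm_ge0//.
Qed.

Let der_derivation : derivation der.
Proof.
move=> a b; rewrite /der lact_bidual_embed ract_bidual_embed -bidual_embedD.
rewrite lact_kpure ract_kpure unitization_mul1 unitization_mulr1.
by rewrite addrC subrK.
Qed.

Let id_is_blin : (fun t : AA => t) \in @is_blin R AA AA.
Proof. by apply/asboolP; split=> // x; exact: cvg_id. Qed.

Lemma lact_sq1 (t : AA) : lact one t = t.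
Proof.
move: t; apply: tensor_square_eq => [||x y].
- exact: (blinP (lact_blin AA one)).
- exact: id_is_blin.
by rewrite lact_sqtens unitization_mul1.
Qed.

Lemma ract_sq1 (t : AA) : ract t one = t.
Proof.
move: t; apply: tensor_square_eq => [||x y].
- exact: (blinP (ract_blin AA one)).
- exact: id_is_blin.
by rewrite ract_sqtens unitization_mulr1.
Qed.

Lemma bidual_sq1 (M : bidual AA) : lact one M = M /\ ract M one = M.
Proof.
split; apply: blin_ext => f.
  rewrite -[LHS]/(M (ract f one)); congr (M _).
  by apply: blin_ext => t; exact: (congr1 f (lact_sq1 t)).
rewrite -[LHS]/(M (lact one f)); congr (M _).
by apply: blin_ext => t; exact: (congr1 f (ract_sq1 t)).
Qed.

(** The element [1 ⊗ 1] has product [1] but fails to commute with [a] by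
    [a ⊗ 1 - 1 ⊗ a]; amenability supplies an [N] in the bidual of the kernel of
    the product with the opposite failure. *)
Lemma virtual_diagonal : amenable A -> exists M : bidual AA,
  bitranspose sqprod M = bidual_embed one /\
  forall x, lact x M = ract M x.
Proof.
move=> amA.
have /asboolP[derl derc] := der_is_blin.
have [N derN] := amA (dual_space KA) der derl derc der_derivation.
pose M : bidual AA := bidual_embed (sqtens one one) + bitranspose kernel_incl N.
exists M; split.
  have -> : bitranspose sqprod M =
      bitranspose sqprod (bidual_embed (sqtens one one)) +
      bitranspose sqprod (bitranspose kernel_incl N) by exact: raddfD.
  have -> : bitranspose sqprod (bitranspose kernel_incl N) = 0.
    apply: blin_ext => f.
    rewrite -[LHS]/(N (transpose kernel_incl (transpose sqprod f))).
    rewrite -[RHS](raddf0 N); congr (N _); apply: blin_ext => t.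
    by rewrite -[LHS]/(f (sqprod (kernel_incl t))) sqprod_kernel_incl raddf0.
  rewrite addr0; apply: blin_ext => f.
  by rewrite -[LHS]/(f (sqprod (sqtens one one))) sqprodE unitization_mul1.
have Mincl a : lact (uincl a) M = ract M (uincl a).
  apply/subr0_eq; rewrite /M lactD ractDl.
  rewrite lact_bidual_embed ract_bidual_embed lact_sqtens ract_sqtens.
  rewrite unitization_mul1 unitization_mulr1.
  have -> : lact (uincl a) (bitranspose kernel_incl N) =
      bitranspose kernel_incl (lact a N).
    apply/esym/transpose_lact; apply: transpose_ract; exact: kernel_incl_lact.
  have -> : ract (bitranspose kernel_incl N) (uincl a) =
      bitranspose kernel_incl (ract N a).
    apply/esym/transpose_ract; apply: transpose_lact => t.
    exact: kernel_incl_ract.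
  rewrite opprD addrACA -[X in _ + X]blin_sub -derN.
  have -> : bitranspose kernel_incl (der a) =
      bidual_embed (kernel_incl (kpure one a)).
    exact: blin_ext.
  rewrite kernel_inclE unitization_mul1; apply: blin_ext => f.
  rewrite blinDE blinBE !bidual_embedE blin_sub.
  by rewrite addrA subrK subrr.
(* The unit of [A_+] commutes with everything, so [A] is enough. *)
move=> x; rewrite (unitizationE x) lactDl ractDr lactZl ractZr Mincl.
by have [-> ->] := bidual_sq1 M.
Qed.

End VirtualDiagonal.

(** * The characterization *)

Theorem corollary3p3 (R : realType) (A : banachAlgType R[i]) :
  amenable A <->
  exists (I : Type) (le : I -> I -> Prop)
      (M : I -> bidual (ptensor (unitization A) (unitization A))),
    [/\ directed_preorder le,
      bitranspose (ptensor_prod (unitization A)) (M nu) @[nu --> net_filter le]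
        --> bidual_embed (unitization_one A) &
      forall S : set (unitization A), bounded_set S ->
        forall e : R, 0 < e ->
          \forall nu \near net_filter le, forall a, S a ->
            `|lact a (M nu) - ract (M nu) a| < e%:C].
Proof.
split=> [/virtual_diagonal[M [M1 Mc]]|[I [le [M [dir M1 Mc]]]]].
  have dir : directed_preorder (fun _ _ : unit => True).
    by split=> //; exists tt.
  have F := net_filter_proper dir.
  exists unit, (fun _ _ => True), (fun _ => M); split=> //.
  - by rewrite -M1; exact: cvg_cst.
  - move=> S _ e e0; exists tt => _ _ a _.
    have -> : lact a M - ract M a = 0 by rewrite Mc subrr.
    by rewrite normr0 ltcR.
have F := net_filter_proper dir.
apply: amenable_approx_diagonal => e e0.
(* On the unit ball, the defect [a . M - M . a] is an operator norm. *)
have ballS : bounded_set [set x : unitization A | rnorm x <= 1].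
  exists 1; split; first exact: real1.
  move=> r r1 x /= x1; rewrite rnormE (le_trans _ (ltW r1))//.
  by rewrite -[1]/(1%:C) lecR.
have near1 : \forall nu \near net_filter le,
    rnorm (bidual_embed (unitization_one A) - bitranspose sqprod (M nu)) < e.
  move/cvgrPdist_lt : M1 => /(_ e%:C); rewrite ltcR => /(_ e0).
  by apply: filterS => nu; rewrite rnormE ltcR.
have [nu [nu1 nuc]] := filter_ex (filterI near1 (Mc _ ballS _ e0)).
exists (M nu); split; first exact: ltW.
apply: opnorm_ball_le => x x1; rewrite innerE -lecR -rnormE.
exact: ltW (nuc x x1).
Qed.
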